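(* Assume (A0)–(A3) as in the context, $r>1$, and that (M$_p$) holds with some $p>1+r$. For $x\in\mathbb{S}$ set $\pi(x):=\mathbb{E}[\ell_1(x)]/\mathbb{E}[\eta_1]$. Then $\pi(x)>0$ for all $x\in\mathbb{S}$, $\sum_{x\in\mathbb{S}}\pi(x)=1$, and for every $x\in\mathbb{S}$, $t^{-1}L_t(x)\to\pi(x)$ a.s. and in $L^q$ for every $q\ge1$. Moreover, if in addition the distribution of $\eta_1$ is not supported on $k\mathbb{N}$ for any integer $k>1$, then $\lim_{t\to\infty}\mathbb{P}[X_t=x]=\pi(x)$ for every $x\in\mathbb{S}$.
   Context: $\mathbb{N}=\{1,2,\dots\}$. (A0): $\mathbb{S}$ is a locally finite (every bounded set meets it in finitely many points), unbounded subset of $[0,\infty)$ with $0\in\mathbb{S}$; $(X_t)_{t\in\mathbb{N}}$ is an $\mathbb{S}$-valued process adapted to a filtration $(\mathcal{F}_t)_{t\in\mathbb{N}}$ with $\mathbb{P}[X_1=0]=1$. (A1): for each $x,y\in\mathbb{S}$ there exist $m(x,y)\in\mathbb{N}$, $\varphi(x,y)>0$ with $\mathbb{P}[X_{t+m(X_t,y)}=y\mid\mathcal{F}_t]\ge\varphi(X_t,y)$ a.s. for all $t$. Write $\Delta_t:=X_{t+1}-X_t$. (A2): there are $c\in\mathbb{R}$, $s^2\in(0,\infty)$ with, as $X_t\to\infty$, $\mathbb{E}[\Delta_t\mid\mathcal{F}_t]=cX_t^{-1}+o(X_t^{-1}(\log X_t)^{-1})$ and $\mathbb{E}[\Delta_t^2\mid\mathcal{F}_t]=s^2+o((\log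 X_t)^{-1})$ a.s., where the implicit constants in $o(\cdot)$ are non-random and uniform in $t$ and in the sample point. Set $r:=-2c/s^2$. Excursions: $\tau_0:=1$, $\tau_n:=\min\{t>\tau_{n-1}:X_t=0\}$ ($\min\emptyset=\infty$), $\eta_n:=\tau_n-\tau_{n-1}$, $\mathcal{E}_n:=(X_t)_{\tau_{n-1}\le t\le\tau_n-1}$, $N:=\min\{n\in\mathbb{N}:\tau_n=\infty\}$. (A3): (a) on $\{N=\infty\}$, $(\mathcal{E}_n)_{n\in\mathbb{N}}$ is i.i.d.; (b) $\mathbb{P}[\eta_{n+1}<\infty\mid\tau_n<\infty]=\mathbb{P}[\eta_1<\infty]$ for all $n$. (M$_p$): there exist $\delta>0$, $C<\infty$ with $\mathbb{E}[|\Delta_t|^p\mid\mathcal{F}_t]\le C(1+X_t)^{p-2-\delta}$ a.s. for all $t$. Occupation times: $L_t(x):=\sum_{s=1}^t\mathbf{1}\{X_s=x\}$ and, for the $n$th excursion, $\ell_n(x):=\sum_{t=\tau_{n-1}}^{\tau_n-1}\mathbf{1}\{X_t=x\}$. *)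

(* Defs.v *)
From HB Require Import structures.
From mathcomp Require Import all_boot all_order all_algebra.
From mathcomp Require Import all_classical all_reals all_analysis.
Set Implicit Arguments. Unset Strict Implicit. Unset Printing Implicit Defensive.
Import Order.TTheory GRing.Theory Num.Theory.
Import numFieldNormedType.Exports.
Local Open Scope classical_set_scope.
Local Open Scope ring_scope.

Section lamperti_defs.
Context {d : measure_display} {T : measurableType d} {R : realType}.
Variable P : probability T R.

(* Time is indexed by nat; only indices t >= 1 are used (paper: t in N = {1,2,...}).
   X t w is the value X_t(w). *)
Implicit Types (X : nat -> T -> R) (F : nat -> set (set T)).

Definition Delta X (t : nat) (w : T) : R := X t.+1 w - X t w.

Lemma next_zero_ex X (s : nat) (w : T) :
  (exists t, (s < t)%N /\ X t w = 0) ->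
  exists t, (s < t)%N && `[< X t w = 0 >].
Proof. by move=> [t [h1 h2]]; exists t; rewrite h1 /=; apply/asboolP. Qed.

(* min { t > s : X_t = 0 }, None standing for +infinity (min of the empty set) *)
Definition next_zero X (s : nat) (w : T) : option nat :=
  match pselect (exists t, (s < t)%N /\ X t w = 0) with
  | left h => Some (ex_minn (next_zero_ex h))
  | right _ => None
  end.

Fixpoint tau X (n : nat) (w : T) : option nat :=
  match n with
  | 0 => Some 1%N
  | n'.+1 => match tau X n' w with
             | Some s => next_zero X s w
             | None => None
             end
  end.

Definition eta X (n : nat) (w : T) : \bar R :=
  match tau X n.-1 w, tau X n w with
  | Some a, Some b => ((b - a)%N%:R)%:E
  | _, _ => +oo%E
  end.

(* the event {N = infinity}, N := min {n : tau_n = infinity} *)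
Definition Ninf X : set T := [set w | forall n, tau X n w <> None].

Definition excursion X (n : nat) (w : T) : seq R :=
  match tau X n.-1 w, tau X n w with
  | Some a, Some b => [seq X t w | t <- iota a (b - a)]
  | _, _ => [::]
  end.

Definition in_exc X (n t : nat) (w : T) : Prop :=
  match tau X n.-1 w, tau X n w with
  | Some a, Some b => (a <= t < b)%N
  | Some a, None => (a <= t)%N
  | None, _ => False
  end.

Definition ell X (n : nat) (x : R) (w : T) : \bar R :=
  (\sum_(t <oo) (if `[< in_exc X n t w /\ X t w = x >] then 1 else 0)%:E)%E.

Definition Locc X (t : nat) (x : R) (w : T) : R :=
  \sum_(1 <= s < t.+1) (X s w == x)%:R.

Definition pi_stat X (x : R) : R :=
  fine (\int[P]_w ell X 1 x w) / fine (\int[P]_w eta X 1 w).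

(* Conditional-expectation bounds, through the defining property of conditional
   expectation.  For a sub-sigma-algebra G, an event E in G, and G-measurable lo, hi:
   "lo <= E[Y | G] <= hi  a.s. on E" is expressed as: for every A in G with A
   contained in E on which Y is integrable, int_A lo <= int_A Y <= int_A hi. *)
Definition cond_exp_between (G : set (set T)) (E : set T) (Y lo hi : T -> R) : Prop :=
  forall A, G A -> A `<=` E -> P.-integrable A (EFin \o Y) ->
    (\int[P]_(w in A) (lo w)%:E <= \int[P]_(w in A) (Y w)%:E)%E /\
    (\int[P]_(w in A) (Y w)%:E <= \int[P]_(w in A) (hi w)%:E)%E.

(* For nonnegative Y: "E[Y | G] <= Z a.s." iff int_A Y <= int_A Z for all A in G. *)
Definition cond_exp_le_nonneg (G : set (set T)) (Y Z : T -> R) : Prop :=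
  forall A, G A -> (\int[P]_(w in A) (Y w)%:E <= \int[P]_(w in A) (Z w)%:E)%E.

(* For an event B: "P[B | G] >= Z a.s." iff int_A Z <= P(A /\ B) for all A in G. *)
Definition cond_prob_ge (G : set (set T)) (B : set T) (Z : T -> R) : Prop :=
  forall A, G A -> (\int[P]_(w in A) (Z w)%:E <= P (A `&` B))%E.

Definition A0 (S : set R) X F : Prop :=
  [/\ S 0, (forall x, S x -> 0 <= x),
      (forall b : R, finite_set [set x | S x /\ x <= b]),
      (forall b : R, exists x, S x /\ b < x) &
  [/\ (forall t, (0 < t)%N -> sigma_algebra setT (F t) /\ F t `<=` measurable),
      (forall s t, (0 < s)%N -> (s <= t)%N -> F s `<=` F t),
      (forall t w, (0 < t)%N -> S (X t w)),
      (forall t y, (0 < t)%N -> F t [set w | X t w = y]) &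
      P [set w | X 1%N w = 0] = 1%E]].

Definition A1 (S : set R) X F : Prop :=
  exists (m : R -> R -> nat) (phi : R -> R -> R),
    (forall x y, S x -> S y -> (0 < m x y)%N /\ 0 < phi x y) /\
    (forall t y, (0 < t)%N -> S y ->
       cond_prob_ge (F t) [set w | X (t + m (X t w) y)%N w = y]
                    (fun w => phi (X t w) y)).

(* (A2) with constants c and s2 = s^2; the o(.) terms are uniform (x0 depends only
   on eps) *)
Definition A2 X F (c s2 : R) : Prop :=
  0 < s2 /\
  forall eps : R, 0 < eps -> exists x0 : R, 1 < x0 /\
    forall t, (0 < t)%N ->
      cond_exp_between (F t) [set w | x0 <= X t w] (Delta X t)
        (fun w => c / X t w - eps / (X t w * ln (X t w)))
        (fun w => c / X t w + eps / (X t w * ln (X t w))) /\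
      cond_exp_between (F t) [set w | x0 <= X t w] (fun w => Delta X t w ^+ 2)
        (fun w => s2 - eps / ln (X t w))
        (fun w => s2 + eps / ln (X t w)).

(* (A3)(a): on {N = oo} the excursions are i.i.d., i.e. under P[ . | N = oo]:
   Q(E_1 in B_0, ..., E_k in B_{k-1}) = prod_i Q(E_1 in B_i), written multiplied out
   by P[N = oo]^(k+1) (vacuous if P[N = oo] = 0). *)
Definition A3a X : Prop :=
  let pN := fine (P (Ninf X)) in
  forall (k : nat) (B : nat -> set (seq R)),
    pN ^+ k * fine (P (Ninf X `&`
        \bigcap_(i in [set i | (i < k)%N]) [set w | B i (excursion X i.+1 w)]))
    = pN * \prod_(i < k) fine (P (Ninf X `&` [set w | B i (excursion X 1 w)])).

(* (A3)(b): P[eta_{n+1} < oo | tau_n < oo] = P[eta_1 < oo], multiplied out. *)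
Definition A3b X : Prop :=
  forall n : nat,
    fine (P [set w | tau X n w <> None /\ (eta X n.+1 w < +oo)%E])
    = fine (P [set w | tau X n w <> None]) * fine (P [set w | (eta X 1 w < +oo)%E]).

Definition Mp X F (p : R) : Prop :=
  exists delta C : R, 0 < delta /\
    forall t, (0 < t)%N ->
      cond_exp_le_nonneg (F t) (fun w => `|Delta X t w| `^ p)
                         (fun w => C * (1 + X t w) `^ (p - 2 - delta)).

Definition eta1_aperiodic X : Prop :=
  forall k : nat, (1 < k)%N ->
    P [set w | exists j : nat, (0 < j)%N /\ eta X 1 w = ((k * j)%N%:R)%:E] <> 1%E.

End lamperti_defs.

(* Main.v *)
(** Foster's criterion with the Lyapunov function [x^2] gives positive recurrence: its
    conditional drift is [2 c + s^2 + o(1)], which is negative far from the origin because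
    [r > 1], while from a bounded set the process reaches 0 within boundedly many steps with
    probability bounded below.  Hence almost surely there are infinitely many excursions and
    the mean excursion length is finite.  By (A3) the excursions are then i.i.d., so the
    strong law of large numbers applied to the occupation numbers and to the lengths of the
    excursions yields the almost sure limit of [L_t(x) / t], and bounded convergence the
    limit in [L^q].  Decomposing [X_t = x] according to the last zero before [t] writes
    [P[X_t = x]] as the convolution of the renewal sequence [P[X_s = 0]] with the summable
    law of the first excursion, and the Erdos-Feller-Pollard renewal theorem concludes.

    The strong law is proved by Garsia's maximal argument, and the renewal theorem by
    comparing [u_n] near its limsup (and liminf) with [u_(n-a)] for [a] in the support of
    the length distribution. *)
Require Import Defs.
From HB Require Import structures.
From mathcomp Require Import all_boot all_order all_algebra.
From mathcomp Require Import all_classical all_reals all_analysis.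
From mathcomp Require Import measurable_realfun zify ring lra.
Import Order.TTheory GRing.Theory Num.Theory.
Import numFieldNormedType.Exports.
Local Open Scope classical_set_scope.
Local Open Scope ring_scope.

Set Implicit Arguments.
Unset Strict Implicit.
Unset Printing Implicit Defensive.

(** * The renewal theorem *)

Section additive_semigroup.
Variable Q : nat -> Prop.
Hypothesis Q0 : Q 0%N.
Hypothesis QD : forall a b, Q a -> Q b -> Q (a + b)%N.

Lemma semigroup_mul n a : Q a -> Q (n * a)%N.
Proof. by move=> Qa; elim: n => // n IH; rewrite mulSn; exact: QD. Qed.

Lemma semigroup_cofinite :
  (forall k, (1 < k)%N -> exists2 a, Q a & ~~ (k %| a)%N) ->
  exists J, forall n, (J <= n)%N -> Q n.
Proof.
move=> aper.
(* [d] is the least positive difference of two elements of [Q]. *)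
have exd : exists d, (0 < d)%N && `[< exists b, Q b /\ Q (b + d)%N >].
  have [a Qa a2] := aper 2%N isT; exists a; apply/andP; split.
    by rewrite lt0n; apply: contra a2 => /eqP ->.
  by apply/asboolP; exists 0%N; rewrite add0n.
have [d /andP[d0 /asboolP[b [Qb Qbd]]] dmin] := ex_minnP exd.
have ddvd a : Q a -> (d %| a)%N.
  move=> Qa; rewrite /dvdn; apply: contraT; rewrite -lt0n => r0.
  have : (d <= a %% d)%N.
    apply: dmin; rewrite r0; apply/asboolP.
    exists (a %/ d * (b + d))%N; split; first exact: semigroup_mul.
    have -> : (a %/ d * (b + d) + a %% d = a + a %/ d * b)%N.
      by rewrite {3}(divn_eq a d); lia.
    by apply: QD => //; exact: semigroup_mul.
  by rewrite leqNgt ltn_pmod.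
have d1 : d = 1%N.
  apply/eqP; rewrite eqn_leq d0 andbT leqNgt; apply/negP => d1.
  by have [a Qa /negP] := aper d d1; apply; exact: ddvd.
rewrite d1 addn1 in Qbd.
exists (b * b)%N => n bn.
have [b0|b0] := posnP b.
  rewrite -(muln1 n); apply: semigroup_mul.
  by rewrite b0 in Qbd.
have rq : (n %% b <= n %/ b)%N.
  apply: (@leq_trans b); first by rewrite ltnW // ltn_pmod.
  by rewrite leq_divRL.
have -> : (n = (n %/ b - n %% b) * b + (n %% b) * b.+1)%N.
  by rewrite mulnS addnCA -mulnDl subnK // addnC -divn_eq.
by apply: QD; exact: semigroup_mul.
Qed.
End additive_semigroup.

Section renewal.
Variable R : realType.
Implicit Types v u rho : nat -> R.

Lemma limsup_exists v : (forall n, 0 <= v n <= 1) ->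
  exists2 l : R, 0 <= l & (forall e, 0 < e -> exists N, forall n, (N <= n)%N -> v n <= l + e) /\
    (forall e N, 0 < e -> exists2 n, (N <= n)%N & l - e <= v n).
Proof.
move=> v01.
pose E := [set a : R | exists N, forall n, (N <= n)%N -> v n <= a].
have E1 : E 1 by exists 0%N => n _; case/andP: (v01 n).
have Elb : lbound E 0.
  by move=> a [N Na]; apply: le_trans (Na N (leqnn N)); case/andP: (v01 N).
have hE : has_inf E by split; [exists 1 | exists 0].
exists (inf E); first by apply: lb_le_inf => //; exists 1.
split.
- move=> e e0; have [a [N Na] ae] := inf_adherent e0 hE.
  by exists N => n /Na /le_trans; apply; exact: ltW.
- move=> e N e0; apply: contrapT => H.
  have : E (inf E - e).
    exists N => n Nn; apply: ltW; rewrite ltNge; apply/negP => ?.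
    by apply: H; exists n.
  move=> /(ge_inf hE.2); lra.
Qed.

Section window.
Variables (v rho : nat -> R).
Hypothesis v01 : forall n, 0 <= v n <= 1.
Hypothesis rho0 : rho 0%N = 1.
Hypothesis rho_ge0 : forall n, 0 <= rho n.
Hypothesis rho_ni : forall n, rho n.+1 <= rho n.
Hypothesis rho_cvg0 : rho @ \oo --> (0 : R).
Hypothesis aper : forall k, (1 < k)%N -> exists2 j, rho j.+1 < rho j & ~~ (k %| j.+1)%N.
Hypothesis v_sub : forall n,
  v n.+1 <= rho n.+1 + \sum_(k < n.+1) (rho k - rho k.+1) * v (n - k)%N.

(* If [v n] is close to its limsup, then so is [v (n - a)] for every [a] in the
   support of the increments of [rho], hence for every large [a]. *)
Lemma limsup_window : exists2 l : R,
  (forall e, 0 < e -> exists N, forall n, (N <= n)%N -> v n <= l + e) &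
  (forall e K N, 0 < e -> exists n, [/\ (N <= n)%N, (K <= n)%N &
      forall j, (j <= K)%N -> l - e <= v (n - j)%N]).
Proof.
have [l l0 [lup llow]] := limsup_exists v01.
exists l => //.
have rho_lt e : 0 < e -> exists N, forall n, (N <= n)%N -> rho n <= e.
  move=> e0; have /cvgrPdist_le/(_ e e0) [N _ HN] := rho_cvg0.
  exists N => n Nn; have := HN n Nn.
  by rewrite sub0r normrN ger0_norm.
pose Q a := forall e, 0 < e -> exists2 dl, 0 < dl & exists N, forall n, (N <= n)%N ->
  l - dl <= v n -> (a <= n)%N /\ l - e <= v (n - a)%N.
have Q0 : Q 0%N.
  by move=> e e0; exists e => //; exists 0%N => n _ h; rewrite subn0.
have QD a b : Q a -> Q b -> Q (a + b)%N.
  move=> Qa Qb e e0.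
  have [d1 d10 [N1 H1]] := Qb e e0.
  have [d2 d20 [N2 H2]] := Qa d1 d10.
  exists d2 => //; exists (N2 + (N1 + a))%N => n Nn ln.
  have [an /H1] := H2 n ltac:(lia) ln.
  move=> []; first lia.
  by rewrite -subnDA => ? ?; split => //; lia.
have Qsupp a : rho a.+1 < rho a -> Q a.+1.
  move=> fa e e0.
  set f := rho a - rho a.+1.
  have f0 : 0 < f by rewrite subr_gt0.
  pose t := f * e / 4.
  have t0 : 0 < t by rewrite divr_gt0 // mulr_gt0.
  have [M0 HM0] := lup t t0.
  have [M1 HM1] := rho_lt t t0.
  exists t => //.
  exists (a + M0 + M1).+2 => -[//|n] Nn ln.
  split; first by lia.
  rewrite subSS.
  have nan : (a < n.+1)%N by lia.
  have := le_trans ln (v_sub n).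
  rewrite (bigD1 (Ordinal nan)) //= -/f.
  set s := \sum_(_ < _ | _) _ => H.
  have s_le : s <= (1 - f) * (l + t) + t.
    have : s <= \sum_(i < n.+1 | i != Ordinal nan)
       ((rho i - rho i.+1) * (l + t) + (rho i - rho i.+1) * (n - M0 < i)%N%:R).
      apply: ler_sum => i _; rewrite -mulrDr ler_wpM2l ?subr_ge0 //.
      case: ltnP => hi; last by rewrite addr0 HM0 //; lia.
      by case/andP: (v01 (n - i)%N) => _ /le_trans; apply; rewrite mulr1n; lra.
    move=> /le_trans; apply; rewrite big_split /=; apply: lerD.
      rewrite -mulr_suml ler_wpM2r //; first lra.
      have : \sum_(i < n.+1) (rho i - rho i.+1) = 1 - rho n.+1.
        rewrite -(big_mkord xpredT (fun i => rho i - rho i.+1)).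
        under eq_bigr do rewrite -opprB.
        by rewrite sumrN telescope_sumr // opprB rho0.
      rewrite (bigD1 (Ordinal nan)) //= -/f.
      have := rho_ge0 n.+1; lra.
    apply: (@le_trans _ _ (\sum_(i < n.+1) (rho i - rho i.+1) * (n - M0 < i)%N%:R)).
      rewrite [leRHS](bigD1 (Ordinal nan)) //= lerDr.
      by rewrite mulr_ge0 // subr_ge0.
    rewrite -(big_mkord xpredT (fun i => (rho i - rho i.+1) * (n - M0 < i)%N%:R)).
    rewrite (big_cat_nat (n := (n - M0)%N)) //=; last by lia.
    rewrite big_nat_cond big1 ?add0r; last first.
      move=> i /andP[/andP[_ hi] _].
      by rewrite ltnNge (ltnW hi) mulr0.
    have : \sum_((n - M0) <= i < n.+1) (rho i - rho i.+1) * (n - M0 < i)%N%:R <=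
           \sum_((n - M0) <= i < n.+1) (rho i - rho i.+1).
      apply: ler_sum => i _; case: (_ < _)%N; rewrite ?mulr1 ?mulr0 //.
      by rewrite subr_ge0.
    move=> /le_trans; apply.
    have -> : \sum_((n - M0) <= i < n.+1) (rho i - rho i.+1) = rho (n - M0)%N - rho n.+1.
      under eq_bigr do rewrite -opprB.
      by rewrite sumrN telescope_sumr ?opprB //; lia.
    have := HM1 (n - M0)%N ltac:(lia); have := rho_ge0 n.+1; lra.
  have r1 := HM1 n.+1 ltac:(lia).
  have f1 : f <= 1.
    have : rho a <= 1.
      by elim: (a) => [|m IH]; rewrite ?rho0 //; apply: le_trans (rho_ni m) IH.
    have := rho_ge0 a.+1; rewrite /f; lra.
  have ft : f * t <= t by rewrite ler_piMl // ltW.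
  have ft0 : 0 <= f * t by rewrite mulr_ge0 // ltW.
  have te : t * 4 = f * e by rewrite /t; field.
  have : f * (l - e) <= f * v (n - a)%N by nra.
  by rewrite ler_pM2l.
have [J HJ] : exists J, forall n, (J <= n)%N -> Q n.
  apply: semigroup_cofinite => // k /aper[j fj kj].
  by exists j.+1 => //; exact: Qsupp.
have QK K e : 0 < e -> exists2 dl, 0 < dl & exists N, forall n, (N <= n)%N ->
    l - dl <= v n -> forall j, (j <= K)%N -> (J + j <= n)%N /\ l - e <= v (n - (J + j))%N.
  move=> e0; elim: K => [|K [d1 d10 [N1 H1]]].
    have [dl dl0 [N H]] := HJ (J + 0)%N ltac:(lia) e e0.
    exists dl => //; exists N => n Nn ln j; rewrite leqn0 => /eqP ->; exact: H.
  have [d2 d20 [N2 H2]] := HJ (J + K.+1)%N ltac:(lia) e e0.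
  exists (Num.min d1 d2); first by rewrite lt_min d10.
  exists (N1 + N2)%N => n Nn ln j; rewrite leq_eqVlt => /orP[/eqP ->|].
    apply: H2; first lia.
    apply: le_trans ln; have : Num.min d1 d2 <= d2 by rewrite ge_min lexx orbT.
    lra.
  rewrite ltnS; apply: H1; first lia.
  apply: le_trans ln; have : Num.min d1 d2 <= d1 by rewrite ge_min lexx.
  lra.
move=> e K N e0.
have [dl dl0 [N1 H1]] := QK K e e0.
have [n nN ln] := llow dl (N1 + N + J)%N dl0.
have [JKn _] := H1 n ltac:(lia) ln K (leqnn _).
exists (n - J)%N; split; [lia..|].
by move=> j jK; rewrite -subnDA; have [] := H1 n ltac:(lia) ln j jK.
Qed.
End window.

Lemma renewal_limit rho u (mu : R) :
  rho 0%N = 1 -> (forall n, 0 <= rho n) -> (forall n, rho n.+1 <= rho n) ->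
  series rho @ \oo --> mu ->
  (forall k, (1 < k)%N -> exists2 j, rho j.+1 < rho j & ~~ (k %| j.+1)%N) ->
  (forall n, 0 <= u n <= 1) ->
  (forall n, \sum_(i < n.+1) rho i * u (n - i)%N = 1) ->
  u @ \oo --> mu^-1.
Proof.
move=> rho0 rho_ge0 rho_ni rho_mu aper u01 conv.
have rho_cvg0 : rho @ \oo --> (0 : R).
  by apply: cvg_series_cvg_0; apply/cvg_ex; exists mu.
have S_ge1 n : 1 <= series rho n.+1.
  by rewrite /series /= big_nat_recl // rho0 lerDl sumr_ge0.
have S_nd : nondecreasing_seq (series rho).
  by apply/nondecreasing_seqP => n; rewrite /series /= big_nat_recr //= lerDl.
have S_le n : series rho n <= mu.
  by rewrite -(cvg_lim _ rho_mu) //; apply: nondecreasing_cvgn_le => //; apply/cvg_ex; exists mu.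
have mu1 : 1 <= mu := le_trans (S_ge1 0%N) (S_le 1%N).
have mu0 : 0 < mu by lra.
have tele n : \sum_(k < n.+1) (rho k - rho k.+1) = 1 - rho n.+1.
  rewrite -(big_mkord xpredT (fun i => rho i - rho i.+1)).
  under eq_bigr do rewrite -opprB.
  by rewrite sumrN telescope_sumr // opprB rho0.
have ren n : u n.+1 = \sum_(k < n.+1) (rho k - rho k.+1) * u (n - k)%N.
  under eq_bigr do rewrite mulrBl.
  rewrite sumrB conv -(conv n.+1) big_ord_recl rho0 mul1r subn0 -addrA.
  rewrite [X in _ + (X - _)](_ : _ = \sum_(i < n.+1) rho i.+1 * u (n - i)%N) ?subrr ?addr0 //.
have low e (e0 : 0 < e) : exists K, mu - e <= series rho K.+1.
  have /cvgrPdist_le/(_ e e0) [K _ HK] := rho_mu.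
  exists K; have := HK K.+1 (leqnSn K); rewrite ler_norml; lra.
have [l1 up1 win1] : exists2 l : R,
  (forall e, 0 < e -> exists N, forall n, (N <= n)%N -> u n <= l + e) &
  (forall e K N, 0 < e -> exists n, [/\ (N <= n)%N, (K <= n)%N &
      forall j, (j <= K)%N -> l - e <= u (n - j)%N]).
  apply: (limsup_window (rho := rho)) => // n.
  by rewrite ren lerDr.
have [l2 up2 win2] : exists2 l : R,
  (forall e, 0 < e -> exists N, forall n, (N <= n)%N -> 1 - u n <= l + e) &
  (forall e K N, 0 < e -> exists n, [/\ (N <= n)%N, (K <= n)%N &
      forall j, (j <= K)%N -> l - e <= 1 - u (n - j)%N]).
  apply: (limsup_window (v := fun n => 1 - u n) (rho := rho)) => //.
    by move=> n; have := u01 n; lra.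
  move=> n; under eq_bigr do rewrite mulrBr mulr1.
  rewrite sumrB tele -ren; lra.
have l1mu : l1 * mu <= 1.
  apply/ler_addgt0Pr => e e0.
  pose t := Num.min (e / (2 * mu)) (e / (2 * (1 + `|l1|))).
  have t0 : 0 < t by rewrite lt_min !divr_gt0 ?mulr_gt0 // ltr_pwDl.
  have [K HK] := low t t0.
  have [n [_ Kn Hn]] := win1 t K 0%N t0.
  have H : (l1 - t) * series rho K.+1 <= 1.
    rewrite -(conv n) -(big_mkord xpredT (fun i => rho i * u (n - i)%N)).
    rewrite (big_cat_nat (n := K.+1)) //= -[leLHS]addr0; apply: lerD; last first.
      by apply: sumr_ge0 => i _; rewrite mulr_ge0 //; case/andP: (u01 (n - i)%N).
    rewrite /series /= mulr_sumr; apply: ler_sum_nat => i /andP[_ iK].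
    by rewrite mulrC ler_wpM2l // Hn.
  have t1 : t * mu <= e / 2.
    have -> : e / 2 = e / (2 * mu) * mu by field; rewrite gt_eqF.
    by rewrite ler_pM2r // ge_min lexx.
  have t2 : t * (1 + `|l1|) <= e / 2.
    have l10 : 0 < 1 + `|l1| by rewrite ltr_pwDl.
    have -> : e / 2 = e / (2 * (1 + `|l1|)) * (1 + `|l1|) by field; rewrite gt_eqF.
    by rewrite ler_pM2r // ge_min lexx orbT.
  have SK := S_le K.+1.
  have l1K : l1 * (mu - series rho K.+1) <= `|l1| * t.
    apply: le_trans (ler_norm _) _; rewrite normrM ler_wpM2l // ger0_norm; lra.
  have tS : t * series rho K.+1 <= t * mu by rewrite ler_wpM2l // ltW.
  nra.
have l2mu : 1 <= (1 - l2) * mu.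
  apply/ler_addgt0Pr => e e0.
  pose t := Num.min (e / (2 * mu)) (e / (2 * (1 + `|l2|))).
  have t0 : 0 < t by rewrite lt_min !divr_gt0 ?mulr_gt0 // ltr_pwDl.
  have [K HK] := low t t0.
  have [n [_ Kn Hn]] := win2 t K 0%N t0.
  have H : 1 <= (1 - l2 + t) * series rho K.+1 + (mu - series rho K.+1).
    rewrite -{1}(conv n) -(big_mkord xpredT (fun i => rho i * u (n - i)%N)).
    rewrite (big_cat_nat (n := K.+1)) //=; apply: lerD.
      rewrite /series /= mulr_sumr; apply: ler_sum_nat => i /andP[_ iK].
      rewrite mulrC ler_wpM2r //; have := Hn i iK; lra.
    have : series rho n.+1 <= mu by [].
    rewrite {1}/series /= (big_cat_nat (n := K.+1)) //= -[X in X + _]/(series rho K.+1).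
    set s1 := (X in _ + X <= _); set s2 := (X in _ -> X <= _).
    have : s2 <= s1.
      apply: ler_sum => i _; rewrite ler_piMr //; by case/andP: (u01 (n - i)%N).
    lra.
  have t1 : t * mu <= e / 2.
    have -> : e / 2 = e / (2 * mu) * mu by field; rewrite gt_eqF.
    by rewrite ler_pM2r // ge_min lexx.
  have t2 : t * (1 + `|l2|) <= e / 2.
    have l10 : 0 < 1 + `|l2| by rewrite ltr_pwDl.
    have -> : e / 2 = e / (2 * (1 + `|l2|)) * (1 + `|l2|) by field; rewrite gt_eqF.
    by rewrite ler_pM2r // ge_min lexx orbT.
  have SK := S_le K.+1.
  have l1K : l2 * (mu - series rho K.+1) <= `|l2| * t.
    apply: le_trans (ler_norm _) _; rewrite normrM ler_wpM2l // ger0_norm; lra.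
  have tS : t * series rho K.+1 <= t * mu by rewrite ler_wpM2l // ltW.
  nra.
have l1V : l1 <= mu^-1 by rewrite -[leRHS]mul1r ler_pdivlMr.
have l2V : mu^-1 <= 1 - l2 by rewrite -[leLHS]mul1r ler_pdivrMr.
apply/cvgrPdist_le => e e0.
have [N1 H1] := up1 e e0; have [N2 H2] := up2 e e0.
exists (N1 + N2)%N => // n /= Nn.
have := H1 n ltac:(lia); have := H2 n ltac:(lia).
rewrite ler_norml; lra.
Qed.
End renewal.

Section ratio.
Variable R : realType.

Lemma cvg_shiftn_div (A : nat -> R) (a : R) :
  (fun n => A n / n%:R) @ \oo --> a -> (fun n => A n.+1 / n%:R) @ \oo --> a.
Proof.
move=> Aa.
rewrite -cvg_shiftS /=.
have h : (fun n => A n.+2 / n.+2%:R) @ \oo --> a.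
  by rewrite (cvg_shiftS (fun n => A n.+1 / n.+1%:R)) (cvg_shiftS (fun n => A n / n%:R)).
have h1 : (fun n => 1 + harmonic n) @ \oo --> (1 : R).
  by rewrite -[X in _ --> X]addr0; apply: cvgD; [exact: cvg_cst|exact: cvg_harmonic].
rewrite -[a]mulr1; apply: cvg_trans (cvgM h h1).
apply: near_eq_cvg; near=> n; rewrite /harmonic /=.
have -> : n.+2%:R = n.+1%:R + 1 :> R by rewrite natr1.
have : 0 < n.+1%:R :> R by []; set m := n.+1%:R => m0.
by field; apply/andP; split; apply: lt0r_neq0; lra.
Unshelve. all: by end_near.
Qed.

Lemma cycle_ratio_cvg (A L : nat -> R) (B : nat -> nat) (a b : R) :
  0 < b -> (forall n, (B n < B n.+1)%N) ->
  (forall n, 0 <= A n) ->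
  (fun n => A n / n%:R) @ \oo --> a ->
  (fun n => (B n)%:R / n%:R) @ \oo --> b ->
  (forall n t, (B n < t)%N -> (t <= B n.+1)%N -> A n <= L t <= A n.+1) ->
  (fun t => L t / t%:R) @ \oo --> a / b.
Proof.
move=> b0 Binc A0 Aa Bb LA.
have ratio (C D : nat -> R) (x y : R) : 0 < y -> (fun n => C n / n%:R) @ \oo --> x ->
    (fun n => D n / n%:R) @ \oo --> y -> (fun n => C n / D n) @ \oo --> x / y.
  move=> y0 Cx Dy.
  have : (fun n => (C n / n%:R) / (D n / n%:R)) @ \oo --> x / y.
    by apply: cvgM => //; apply: cvgV => //; rewrite gt_eqF.
  apply: cvg_trans; apply: near_eq_cvg; exists 1%N => // n /= n0.
  rewrite invf_div mulrA divfK // pnatr_eq0; lia.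
have up := ratio _ _ _ _ b0 (cvg_shiftn_div Aa) Bb.
have lo := ratio _ _ _ _ b0 Aa (cvg_shiftn_div Bb).
apply/cvgrPdist_le => e e0.
move/cvgrPdist_le/(_ e e0) : up => [N1 _ H1].
move/cvgrPdist_le/(_ e e0) : lo => [N2 _ H2].
have Bmono : {homo B : m n / (m <= n)%N}.
  by apply: homo_leq => //; [exact: leq_trans|move=> n; exact: ltnW].
have Bge n : (n <= B n)%N.
  by elim: n => // n IH; apply: leq_ltn_trans IH _.
exists (B (N1 + N2 + 1)%N).+1 => // t /= Bt.
have ext : exists n, (B n < t)%N by exists (N1 + N2 + 1)%N.
have bt n : (B n < t)%N -> (n <= t)%N by move=> /ltnW; exact: leq_trans (Bge n).
have [n Bn nmax] := ex_maxnP ext bt.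
have nN : (N1 + N2 + 1 <= n)%N by exact: nmax.
have tB : (t <= B n.+1)%N.
  by rewrite leqNgt; apply/negP => /nmax; rewrite ltnn.
have /andP[l1 l2] := LA n t Bn tB.
have B_gt0 : 0 < (B n)%:R :> R by rewrite ltr0n; have := Bge n; lia.
have Bt' : (B n)%:R <= t%:R :> R by rewrite ler_nat ltnW.
have tB' : t%:R <= (B n.+1)%:R :> R by rewrite ler_nat.
have t0 : 0 < t%:R :> R by exact: lt_le_trans Bt'.
have N1n : (N1 <= n)%N by lia.
have N2n : (N2 <= n)%N by lia.
have := H1 n N1n; have := H2 n N2n.
have up' : L t / t%:R <= A n.+1 / (B n)%:R.
  by apply: ler_pM => //; rewrite ?invr_ge0 ?(ltW t0) ?lef_pV2 ?posrE //; exact: le_trans (A0 n) l1.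
have lo' : A n / (B n.+1)%:R <= L t / t%:R.
  by apply: ler_pM => //; rewrite ?invr_ge0 // lef_pV2 // posrE // (lt_le_trans t0).
rewrite !ler_norml; lra.
Qed.
End ratio.

(** * Random elements with countable range *)

Section discrete_random_elements.
Context {d : measure_display} {T : measurableType d} {R : realType}.
Variable P : probability T R.

Definition discrete_rv (U : Type) (f : T -> U) :=
  countable (range f) /\ forall B : set U, measurable (f @^-1` B).

Lemma countable_bigcup_measurable (U : Type) (D : set U) (F : U -> set T) :
  countable D -> (forall i, D i -> measurable (F i)) ->
  measurable (\bigcup_(i in D) F i).
Proof.
move=> cD mF; rewrite bigcup_set_type; apply: countable_bigcupT_measurable.
  by rewrite (eq_countable (card_setT D)).
by move=> i; apply: mF; exact: set_valP.
Qed.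

Lemma discrete_cst (U : Type) (u : U) : discrete_rv (fun=> u).
Proof.
split.
  apply: (@sub_countable _ _ _ [set u]); last exact: countable1.
  by apply: subset_card_le => _ [w _ <-].
move=> B; have [Bu|Bu] := pselect (B u).
  by rewrite (_ : _ @^-1` _ = setT)//; apply/seteqP; split.
by rewrite (_ : _ @^-1` _ = set0)//; apply/seteqP; split.
Qed.

Lemma discrete_bind (U V : Type) (f : T -> U) (g : U -> T -> V) :
  discrete_rv f -> (forall u, discrete_rv (g u)) ->
  discrete_rv (fun w => g (f w) w).
Proof.
move=> [cf mf] dg; split.
  apply: (@sub_countable _ _ _ (\bigcup_(u in range f) range (g u))).
    by apply: subset_card_le => _ [w _ <-]; exists (f w).
  by apply: bigcup_countable => // u _; have [] := dg u.
move=> B; rewrite (_ : _ @^-1` _ = \bigcup_(u in range f)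
    (f @^-1` [set u] `&` g u @^-1` B)).
  apply: countable_bigcup_measurable => // u _; apply: measurableI; first exact: mf.
  by have [_] := dg u; apply.
apply/seteqP; split => w /=; first by move=> ?; exists (f w).
by move=> [_ _ [<-]].
Qed.

Lemma discrete_comp (U V : Type) (f : T -> U) (h : U -> V) :
  discrete_rv f -> discrete_rv (fun w => h (f w)).
Proof.
move=> df; apply: (@discrete_bind _ _ f (fun u _ => h u)) => // u.
exact: discrete_cst.
Qed.

Lemma discrete_comp2 (U V W : Type) (f : T -> U) (g : T -> V) (h : U -> V -> W) :
  discrete_rv f -> discrete_rv g -> discrete_rv (fun w => h (f w) (g w)).
Proof.
move=> df dg; apply: (@discrete_bind _ _ f (fun u w => h u (g w))) => // u.
exact: discrete_comp.
Qed.

Lemma discrete_seq (U : Type) (I : eqType) (f : I -> T -> U) (s : seq I) :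
  {in s, forall i, discrete_rv (f i)} -> discrete_rv (fun w => [seq f i w | i <- s]).
Proof.
elim: s => [_|i s IH H] /=; first exact: discrete_cst.
apply: (@discrete_comp2 _ _ _ (f i) _ cons); first by apply: H; rewrite mem_head.
by apply: IH => j js; apply: H; rewrite in_cons js orbT.
Qed.

Lemma discrete_measurable (U : Type) (f : T -> U) (B : set U) :
  discrete_rv f -> measurable [set w | B (f w)].
Proof. by move=> [_]; apply. Qed.

Lemma discrete_measurable_fun d' (V : sigmaRingType d') (D : set T) (f : T -> V) :
  discrete_rv f -> measurable_fun D f.
Proof. by move=> [_ mf] mD B mB; apply: measurableI. Qed.

Lemma prob_fineK (A : set T) : measurable A -> (fine (P A))%:E = P A.
Proof. by move=> mA; rewrite fineK // fin_num_measure. Qed.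

Lemma prob_fine_ge0 (A : set T) : 0 <= fine (P A).
Proof. exact: fine_ge0. Qed.

Lemma prob_fine_le1 (A : set T) : measurable A -> fine (P A) <= 1.
Proof. by move=> mA; rewrite -lee_fin prob_fineK // probability_le1. Qed.

Lemma integral_cst_fine (A : set T) (r : R) : measurable A ->
  (\int[P]_(w in A) r%:E = (r * fine (P A))%:E)%E.
Proof. by move=> mA; rewrite (integral_cst P mA) EFinM prob_fineK. Qed.

Lemma discrete_integralE (U : Type) (C : set U) (k : U -> nat) (f : T -> U)
    (A : set T) (g : U -> \bar R) :
  {in C &, injective k} -> discrete_rv f -> range f `<=` C -> measurable A ->
  (forall u, 0 <= g u)%E ->
  (\int[P]_(w in A) g (f w) = \sum_(n <oo)
     (if pselect (exists2 u, C u & k u = n) is left h then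
        let u := projT1 (cid2 h) in g u * P (A `&` [set w | f w = u])
      else 0))%E.
Proof.
move=> kinj df fC mA g0.
pose F n := A `&` [set w | k (f w) = n].
have mF n : measurable (F n).
  by apply: measurableI => //; exact: (discrete_measurable (fun u => k u = n) df).
have AF : A = \bigcup_n F n.
  by apply/seteqP; split=> [w Aw|w [n _ []//]]; exists (k (f w)).
rewrite [in LHS]AF ge0_integral_bigcup //; last 2 first.
- by apply: discrete_measurable_fun; exact: discrete_comp.
- by apply/trivIsetP => i j _ _; apply: contraNeq => /set0P[w [[_ <-] [_ <-]]].
apply: eq_eseriesr => n _; case: pselect => [h|h].
  case: cid2 => u Cu ku /=.
  have FE : F n = A `&` [set w | f w = u].
    apply/seteqP; split => w [Aw /= fw]; split => //=; last by rewrite fw.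
    by apply: kinj; rewrite ?inE ?ku//; apply: fC; exists w.
  rewrite (eq_integral (cst (g u))); last by move=> w; rewrite inE FE => -[_ /= ->].
  by rewrite integral_cst // FE.
rewrite (_ : F n = set0) ?integral_set0 //.
apply/seteqP; split => w // [Aw /= kw]; apply: h.
by exists (f w) => //; apply: fC; exists w.
Qed.

Lemma discrete_integral_eq (U : Type) (f1 f2 : T -> U) (A1 A2 : set T) (a : R)
    (g : U -> \bar R) :
  discrete_rv f1 -> discrete_rv f2 -> measurable A1 -> measurable A2 ->
  (forall u, P (A1 `&` [set w | f1 w = u]) = a%:E * P (A2 `&` [set w | f2 w = u]))%E ->
  (forall u, 0 <= g u)%E ->
  (\int[P]_(w in A1) g (f1 w) = a%:E * \int[P]_(w in A2) g (f2 w))%E.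
Proof.
move=> df1 df2 mA1 mA2 H g0.
have cC : countable (range f1 `|` range f2).
  rewrite -bigcup2E; apply: bigcup_countable; first exact: countableP.
  by move=> [|[|i]] _ /=; [exact: df1.1|exact: df2.1|exact: countable0].
have /countable_injP[k kinj] := cC.
rewrite (discrete_integralE kinj df1) //.
rewrite (discrete_integralE kinj df2) //.
rewrite -nneseriesZl; last first.
  by move=> i _; case: pselect => // h; rewrite mule_ge0.
apply: eq_eseriesr => n _; case: pselect => [h|h]; last by rewrite mule0.
by rewrite /= H muleCA.
Qed.

Lemma discrete_prob_eq (U : Type) (f1 f2 : T -> U) (A1 A2 : set T) (a : R) (B : set U) :
  discrete_rv f1 -> discrete_rv f2 -> measurable A1 -> measurable A2 ->
  (forall u, P (A1 `&` [set w | f1 w = u]) = a%:E * P (A2 `&` [set w | f2 w = u]))%E ->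
  (P (A1 `&` [set w | B (f1 w)]) = a%:E * P (A2 `&` [set w | B (f2 w)]))%E.
Proof.
move=> df1 df2 mA1 mA2 H.
have E f A : discrete_rv f -> measurable A ->
    (P (A `&` [set w | B (f w)]) = \int[P]_(w in A) (\1_B (f w))%:E)%E.
  move=> df mA; rewrite setIC -(integral_indic _ mA) //; exact: discrete_measurable.
rewrite !E //; apply: (discrete_integral_eq (g := fun u => (\1_B u)%:E)) => // u.
Qed.

Lemma prob_bigcap_bigcup_eq (F G : nat -> nat -> set T) (a : R) :
  (forall i j, measurable (F i j)) -> (forall i j, measurable (G i j)) ->
  (forall i, nondecreasing_seq (F i)) -> (forall i, nondecreasing_seq (G i)) ->
  (forall j, nonincreasing_seq (F ^~ j)) -> (forall j, nonincreasing_seq (G ^~ j)) ->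
  (forall i j, P (F i j) = a%:E * P (G i j))%E ->
  (P (\bigcap_i \bigcup_j F i j) = a%:E * P (\bigcap_i \bigcup_j G i j))%E.
Proof.
move=> mF mG Fnd Gnd Fni Gni FG.
have mu (F' : nat -> nat -> set T) i : (forall i j, measurable (F' i j)) ->
    measurable (\bigcup_j F' i j).
  by move=> mF'; apply: bigcup_measurable.
have ni (F' : nat -> nat -> set T) : (forall j, nonincreasing_seq (F' ^~ j)) ->
    nonincreasing_seq (fun i => \bigcup_j F' i j : set T).
  move=> h m n mn; apply/subsetPset => w [j _ Fj]; exists j => //.
  by have /subsetPset := h j m n mn; apply.
have lu (F' : nat -> nat -> set T) i : (forall i j, measurable (F' i j)) ->
    nondecreasing_seq (F' i) -> (fun j => P (F' i j)) @ \oo --> P (\bigcup_j F' i j).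
  by move=> mF' h; apply: nondecreasing_cvg_mu => //; exact: mu.
have ln (F' : nat -> nat -> set T) : (forall i j, measurable (F' i j)) ->
    (forall j, nonincreasing_seq (F' ^~ j)) ->
    (fun i => P (\bigcup_j F' i j)) @ \oo --> P (\bigcap_i \bigcup_j F' i j).
  move=> mF' h; apply: nonincreasing_cvg_mu => //.
  - by rewrite -ge0_fin_numE // fin_num_measure //; exact: mu.
  - by move=> i; exact: mu.
  - by apply: bigcap_measurable => // i _; exact: mu.
  - exact: ni.
have FG1 i : (P (\bigcup_j F i j) = a%:E * P (\bigcup_j G i j))%E.
  rewrite -(cvg_lim _ (lu F i mF (Fnd i))) //; apply: cvg_lim => //.
  by rewrite (eq_cvg _ _ (FG i)); apply: cvgeZl => //; exact: (lu G).
rewrite -(cvg_lim _ (ln F mF Fni)) //; apply: cvg_lim => //.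
by rewrite (eq_cvg _ _ FG1); apply: cvgeZl => //; exact: (ln G).
Qed.

End discrete_random_elements.

(** * The strong law of large numbers *)

Section iid_sequences.
Context {d : measure_display} {T : measurableType d} {R : realType}.
Variable P : probability T R.
Variables (U : Type) (Y : nat -> T -> U).
Hypothesis dY : forall i, discrete_rv (Y i).

Local Notation p B := (fine (P [set w | B (Y 0 w)])).

Hypothesis iidY : forall (k : nat) (B : nat -> set U),
  fine (P (\bigcap_(i in [set i | (i < k)%N]) [set w | B i (Y i w)])) = \prod_(i < k) p (B i).

Definition segment (a n : nat) (w : T) : seq U := [seq Y i w | i <- iota a n].

Lemma discrete_segment a n : discrete_rv (segment a n).
Proof. by apply: discrete_seq. Qed.

Fixpoint all_in (Bs : seq (set U)) (a : nat) (w : T) : Prop :=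
  if Bs is B :: Bs' then B (Y a w) /\ all_in Bs' a.+1 w else True.

Lemma all_in_nth Bs a w :
  all_in Bs a w <-> forall i, (i < size Bs)%N -> nth setT Bs i (Y (a + i) w).
Proof.
elim: Bs a => [|B Bs IH] a /=; first by split.
rewrite IH; split=> [[Ba H] [_|i]|H].
- by rewrite addn0.
- by rewrite ltnS addnS -addSn; exact: H.
- split=> [|i iB]; first by have := H 0%N isT; rewrite addn0.
  by have := H i.+1 iB; rewrite addnS -addSn.
Qed.

Lemma all_in_cat Bs Cs a w :
  all_in (Bs ++ Cs) a w <-> all_in Bs a w /\ all_in Cs (a + size Bs) w.
Proof.
elim: Bs a => [|B Bs IH] a /=; first by rewrite addn0; split=> [|[]].
by rewrite IH addnS -addSn; tauto.
Qed.

Lemma measurable_all_in Bs a : measurable [set w | all_in Bs a w].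
Proof.
elim: Bs a => [|B Bs IH] a /=; first by rewrite (_ : mkset _ = setT)//; apply/seteqP; split.
rewrite (_ : mkset _ = [set w | B (Y a w)] `&` [set w | all_in Bs a.+1 w]) //.
by apply: measurableI => //; exact: (discrete_measurable B (dY a)).
Qed.

Lemma prob_all_in Bs a :
  P [set w | all_in Bs a w] = (\prod_(B <- Bs) p B)%:E.
Proof.
rewrite -prob_fineK; last exact: measurable_all_in.
congr (_%:E).
have := iidY (a + size Bs) (fun i => if (i < a)%N then setT else nth setT Bs (i - a)).
rewrite big_split_ord /= big1 ?mul1r; last first.
  by move=> i _; rewrite ltn_ord (_ : mkset _ = setT) ?probability_setT//; apply/seteqP; split.
rewrite [X in _ = X -> _](_ : _ = \prod_(B <- Bs) p B); last first.
  rewrite (big_nth setT) big_mkord; apply: eq_bigr => i _.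
  by rewrite ltnNge leq_addr /= addKn.
move=> <-; congr (fine (P _)); apply/seteqP; split => w.
  move=> /all_in_nth H i /= iB; case: ltnP => // ai.
  by have := H (i - a)%N; rewrite subnKC //; apply; lia.
move=> H; apply/all_in_nth => i iB; have := H (a + i)%N.
by rewrite /= (_ : (a + i < a)%N = false) ?addKn; [apply; rewrite /= ltn_add2l|lia].
Qed.

Lemma all_in_set1 l a w : all_in [seq [set u] | u <- l] a w <-> segment a (size l) w = l.
Proof.
elim: l a => [|u l IH] a /=; first by split.
rewrite IH /segment /=; by split=> [[-> ->]//|[<- h]]; split => //; rewrite h.
Qed.

Lemma segment_neq_size a n w l : size l <> n -> segment a n w <> l.
Proof. by move=> ln E; apply: ln; rewrite -E size_map size_iota. Qed.

Lemma prob_segment_shift n (B : set (seq U)) a :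
  P [set w | B (segment a n w)] = P [set w | B (segment 0 n w)].
Proof.
have := @discrete_prob_eq _ _ _ P _ (segment a n) (segment 0 n) setT setT 1 B.
rewrite !setTI mul1e; apply => //; [exact: discrete_segment..|].
move=> l; rewrite !setTI mul1e.
have [<-|/eqP ln] := eqVneq (size l) n.
  have E b : [set w | segment b (size l) w = l] =
      [set w | all_in [seq [set u] | u <- l] b w].
    by apply/seteqP; split => w /all_in_set1.
  by rewrite !E !prob_all_in.
have E b : [set w | segment b n w = l] = set0.
  by apply/seteqP; split => w //=; exact: segment_neq_size.
by rewrite !E.
Qed.

Lemma prob_head_segment n (B : set U) (D : set (seq U)) :
  P ([set w | B (Y 0 w)] `&` [set w | D (segment 1 n w)]) =
  ((p B)%:E * P [set w | D (segment 1 n w)])%E.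
Proof.
have mB : measurable [set w | B (Y 0 w)] by exact: discrete_measurable.
rewrite -[X in (_ * P X)%E]setTI.
apply: (discrete_prob_eq (f1 := segment 1 n) (f2 := segment 1 n)) => //;
  [exact: discrete_segment..|].
move=> l; rewrite setTI.
have [<-|/eqP ln] := eqVneq (size l) n; last first.
  have -> : [set w | segment 1 n w = l] = set0.
    by apply/seteqP; split => w //=; exact: segment_neq_size.
  by rewrite setI0 measure0 mule0.
have E : [set w | segment 1 (size l) w = l] = [set w | all_in [seq [set u] | u <- l] 1 w].
  by apply/seteqP; split => w /all_in_set1.
have E' : [set w | B (Y 0 w)] `&` [set w | segment 1 (size l) w = l] =
    [set w | all_in (B :: [seq [set u] | u <- l]) 0 w].
  by rewrite E.
by rewrite E' E !prob_all_in big_cons EFinM.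
Qed.

Lemma prob_segment_next n (B : set U) (D : set (seq U)) :
  P ([set w | B (Y n w)] `&` [set w | D (segment 0 n w)]) =
  ((p B)%:E * P [set w | D (segment 0 n w)])%E.
Proof.
have mB : measurable [set w | B (Y n w)] by exact: discrete_measurable.
rewrite -[X in (_ * P X)%E]setTI.
apply: (discrete_prob_eq (f1 := segment 0 n) (f2 := segment 0 n)) => //;
  [exact: discrete_segment..|].
move=> l; rewrite setTI.
have [<-|/eqP ln] := eqVneq (size l) n; last first.
  have -> : [set w | segment 0 n w = l] = set0.
    by apply/seteqP; split => w //=; exact: segment_neq_size.
  by rewrite setI0 measure0 mule0.
have E : [set w | segment 0 (size l) w = l] = [set w | all_in [seq [set u] | u <- l] 0 w].
  by apply/seteqP; split => w /all_in_set1.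
have E' : [set w | B (Y (size l) w)] `&` [set w | segment 0 (size l) w = l] =
    [set w | all_in ([seq [set u] | u <- l] ++ [:: B]) 0 w].
  rewrite E; apply/seteqP; split => w /=.
    by move=> [Bw H]; apply/all_in_cat; split => //=; rewrite add0n size_map.
  by move=> /all_in_cat /= [H []]; rewrite add0n size_map.
by rewrite E' E !prob_all_in big_cat big_seq1 /= mulrC EFinM.
Qed.

Lemma integral_iid_eq n (g : U -> \bar R) : (forall u, 0 <= g u)%E ->
  (\int[P]_w g (Y n w) = \int[P]_w g (Y 0 w))%E.
Proof.
move=> g0; rewrite (@discrete_integral_eq _ _ _ P _ (Y n) (Y 0) setT setT 1) ?mul1e//.
move=> u; rewrite !setTI mul1e.
have E b : [set w | Y b w = u] = [set w | all_in [:: [set u]] b w].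
  by apply/seteqP; split => w //= [].
by rewrite !E !prob_all_in.
Qed.

Section maximal.
Variable z : U -> R.

(* The maximum of 0 and of the sums of [z] over the initial segments of the list. *)
Fixpoint max_sum (s : seq U) : R :=
  if s is u :: s' then Num.max 0 (z u + max_sum s') else 0.

Lemma max_sum_ge0 s : 0 <= max_sum s.
Proof. by case: s => //= u s; rewrite le_max lexx. Qed.

Lemma sum_le_max_sum s : \sum_(u <- s) z u <= max_sum s.
Proof.
elim: s => [|u s IH] /=; first by rewrite big_nil.
by rewrite big_cons le_max lerD2l IH orbT.
Qed.

Lemma max_sum_segmentS a n w : max_sum (segment a n w) <= max_sum (segment a n.+1 w).
Proof.
elim: n a => [|n IH] a; first exact: max_sum_ge0.
rewrite /segment /= -!/(segment _ _ _).
by rewrite ge_max le_max lexx /= le_max; apply/orP; right; rewrite lerD2l; exact: IH.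
Qed.

Lemma max_sum_segment_homo a w :
  {homo (fun n => max_sum (segment a n w)) : m n / (m <= n)%N >-> m <= n}.
Proof. by apply: homo_leq => [//|? ? ?|n]; [exact: le_trans|exact: max_sum_segmentS]. Qed.

Definition unbounded_from (a : nat) : set T :=
  \bigcap_K \bigcup_n [set w | K%:R <= max_sum (segment a n w)].

Lemma measurable_unbounded_from a : measurable (unbounded_from a).
Proof.
apply: bigcap_measurable => // K _; apply: bigcup_measurable => n _.
apply: (@discrete_measurable _ _ _ (segment a n) (fun s => K%:R <= max_sum s)).
exact: discrete_segment.
Qed.

Lemma unbounded_from01 : unbounded_from 0 = unbounded_from 1.
Proof.
have E n w : max_sum (segment 0 n.+1 w) = Num.max 0 (z (Y 0 w) + max_sum (segment 1 n w)).
  by [].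
apply/seteqP; split => w H K _.
  have [n _ /=] := H (K + (Num.trunc `|z (Y 0 w)|)).+1 I.
  case: n => [|n]; first by rewrite lern0.
  rewrite E le_max lern0 /= => h; exists n => //=.
  have := truncnS_gt `|z (Y 0 w)|.
  have := ler_norm (z (Y 0 w)).
  move: h; rewrite -addnS natrD; lra.
have [n _ /=] := H (K + (Num.trunc `|z (Y 0 w)|)).+1 I.
move=> h; exists n.+1 => //; rewrite /mkset E le_max; apply/orP; right.
have := truncnS_gt `|z (Y 0 w)|.
have := ler_norm (- z (Y 0 w)); rewrite normrN.
move: h; rewrite -addnS natrD; lra.
Qed.

Lemma prob_unbounded_segment l n a :
  P (unbounded_from a `&` [set w | segment a n w = l]) =
  P (unbounded_from 0 `&` [set w | segment 0 n w = l]).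
Proof.
pose F b (i j : nat) := [set w | i%:R <= max_sum (segment b j w)] `&` [set w | segment b n w = l].
have FE b : unbounded_from b `&` [set w | segment b n w = l] = \bigcap_i \bigcup_j F b i j.
  apply/seteqP; split => w.
    by move=> [H wl] i _; have [j _ ?] := H i I; exists j.
  move=> H; split => [i _|]; first by have [j _ []] := H i I; exists j.
  by have [j _ []] := H 0%N I.
have mF b i j : measurable (F b i j).
  apply: measurableI.
    apply: (@discrete_measurable _ _ _ (segment b j) (fun s => i%:R <= max_sum s)).
    exact: discrete_segment.
  apply: (@discrete_measurable _ _ _ (segment b n) (fun s => s = l)); exact: discrete_segment.
rewrite !FE -[RHS]mul1e; apply: prob_bigcap_bigcup_eq => //.
- move=> i j k jk; apply/subsetPset => w [/= h wl]; split => //=.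
  by apply: le_trans h _; exact: max_sum_segment_homo.
- move=> i j k jk; apply/subsetPset => w [/= h wl]; split => //=.
  by apply: le_trans h _; exact: max_sum_segment_homo.
- move=> j i k ik; apply/subsetPset => w [/= h wl]; split => //=.
  by apply: le_trans h; rewrite ler_nat.
- move=> j i k ik; apply/subsetPset => w [/= h wl]; split => //=.
  by apply: le_trans h; rewrite ler_nat.
move=> i j; rewrite mul1e.
have E b : F b i j = [set w |
    (fun s => i%:R <= max_sum (take j s) /\ take n s = l) (segment b (n + j) w)].
  have tk m k w : (m <= k)%N -> take m (segment b k w) = segment b m w.
    by move=> mk; rewrite /segment -map_take take_iota; congr map; congr iota; lia.
  by apply/seteqP; split => w /=; rewrite !tk ?leq_addr ?leq_addl.
rewrite !E; exact: (prob_segment_shift (n + j)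
  (fun s => i%:R <= max_sum (take j s) /\ take n s = l) a).
Qed.

Lemma prob_head_unbounded (u : U) :
  P (unbounded_from 1 `&` [set w | Y 0 w = u]) =
  ((fine (P (unbounded_from 1)))%:E * P (setT `&` [set w | Y 0 w = u]))%E.
Proof.
rewrite setTI setIC prob_fineK; last exact: measurable_unbounded_from.
have mu : measurable [set w | Y 0 w = u].
  exact: (discrete_measurable (fun v => v = u)).
rewrite muleC -(prob_fineK P mu).
have -> : [set w | Y 0 w = u] `&` unbounded_from 1 = \bigcap_i \bigcup_j
    ([set w | Y 0 w = u] `&` [set w | i%:R <= max_sum (segment 1 j w)]).
  apply/seteqP; split => w.
    by move=> [wu H] i _; have [j _ ?] := H i I; exists j.
  move=> H; split => [|i _]; last by have [j _ []] := H i I; exists j.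
  by have [j _ []] := H 0%N I.
have mF i j : measurable [set w | i%:R <= max_sum (segment 1 j w)].
  apply: (@discrete_measurable _ _ _ (segment 1 j) (fun s => i%:R <= max_sum s)).
  exact: discrete_segment.
apply: prob_bigcap_bigcup_eq => //.
- by move=> i j; exact: measurableI.
- move=> i j k jk; apply/subsetPset => w [/= wu h]; split => //=.
  by apply: le_trans h _; exact: max_sum_segment_homo.
- move=> i j k jk; apply/subsetPset => w /= h.
  by apply: le_trans h _; exact: max_sum_segment_homo.
- move=> j i k ik; apply/subsetPset => w [/= wu h]; split => //=.
  by apply: le_trans h; rewrite ler_nat.
- move=> j i k ik; apply/subsetPset => w /= h.
  by apply: le_trans h; rewrite ler_nat.
by move=> i j; exact: (prob_head_segment _ (fun v => v = u) (fun s => i%:R <= max_sum s)).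
Qed.

Hypothesis iz : P.-integrable setT (fun w => (z (Y 0 w))%:E).

Lemma discrete_z a : discrete_rv (fun w => (z (Y a w))%:E).
Proof. exact: (@discrete_comp _ _ _ _ (Y a) (fun u => (z u)%:E)). Qed.

Lemma integrable_z a : P.-integrable setT (fun w => (z (Y a w))%:E).
Proof.
apply/integrableP; split; first by apply: discrete_measurable_fun; exact: discrete_z.
have /integrableP[_] := iz.
by rewrite -(@integral_iid_eq a (fun u => `|(z u)%:E|)%E).
Qed.

Lemma discrete_max_sum a n : discrete_rv (fun w => (max_sum (segment a n w))%:E).
Proof.
apply: (@discrete_comp _ _ _ _ (segment a n) (fun s => (max_sum s)%:E)).
exact: discrete_segment.
Qed.

Lemma integrable_max_sum a n : P.-integrable setT (fun w => (max_sum (segment a n w))%:E).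
Proof.
elim: n a => [|n IH] a; first exact: integrable0.
apply: (@le_integrable _ _ _ _ _ measurableT _
   (fun w => `|(z (Y a w))%:E| + (max_sum (segment a.+1 n w))%:E)%E).
- by apply: discrete_measurable_fun; exact: discrete_max_sum.
- move=> w _; rewrite /= lee_fin ger0_norm; last by rewrite le_max lexx.
  rewrite -/(segment a.+1 n w).
  have := max_sum_ge0 (segment a.+1 n w); have := ler_norm (z (Y a w)).
  have := normr_ge0 (z (Y a w)).
  move=> h1 h2 h3; rewrite [leRHS]ger0_norm; last lra.
  rewrite ge_max; apply/andP; split; lra.
- apply: integrableD => //; apply: integrable_abse; exact: integrable_z.
Qed.

(* Garsia's argument: on the shift-invariant event that the partial sums are unbounded above,
   [max_sum (segment 0 n.+1) - max_sum (segment 1 n)] has nonnegative mean and tends to [z (Y 0)]. *)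
Lemma integral_unbounded_ge0 : (0 <= \int[P]_(w in unbounded_from 0) (z (Y 0 w))%:E)%E.
Proof.
have mA := measurable_unbounded_from 0.
pose D n w : R := Num.max (- max_sum (segment 1 n w)) (z (Y 0 w)).
have DE n w : D n w = max_sum (segment 0 n.+1 w) - max_sum (segment 1 n w).
  rewrite /= -/(segment 1 n w) /D; case: (leP 0 _) => h.
    by rewrite addrK max_r //; lra.
  by rewrite max_l ?sub0r //; lra.
have dD n : discrete_rv (fun w => (D n w)%:E).
  apply: (@discrete_comp2 _ _ _ _ _ (segment 1 n) (Y 0)
    (fun s u => (Num.max (- max_sum s) (z u))%:E)) => //; exact: discrete_segment.
have sA (f : T -> \bar R) : P.-integrable setT f -> P.-integrable (unbounded_from 0) f.
  by apply: integrableS.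
have D0 n : (0 <= \int[P]_(w in unbounded_from 0) (D n w)%:E)%E.
  under eq_integral do rewrite DE EFinB.
  rewrite integralB_EFin //; [|exact/sA/integrable_max_sum..].
  rewrite sube_ge0; last first.
    by apply/orP; left; apply: integrable_fin_num => //; exact/sA/integrable_max_sum.
  have -> : (\int[P]_(w in unbounded_from 0) (max_sum (segment 1 n w))%:E =
      \int[P]_(w in unbounded_from 0) (max_sum (segment 0 n w))%:E)%E.
    rewrite [in LHS]unbounded_from01 -[RHS]mul1e.
    apply: (@discrete_integral_eq _ _ _ P _ (segment 1 n) (segment 0 n) _ _ 1
        (fun s => (max_sum s)%:E));
      [exact: discrete_segment..|exact: measurable_unbounded_from|exact: mA| |].
      by move=> l; rewrite mul1e prob_unbounded_segment.
    by move=> s; rewrite lee_fin max_sum_ge0.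
  apply: ge0_le_integral => //.
  - by move=> w _; rewrite lee_fin max_sum_ge0.
  - by apply: discrete_measurable_fun; exact: discrete_max_sum.
  - by apply: discrete_measurable_fun; exact: discrete_max_sum.
  - by move=> w _; rewrite lee_fin max_sum_segmentS.
have [_ _ cv] : [/\ P.-integrable (unbounded_from 0) (fun w => (z (Y 0 w))%:E),
   (fun n => \int[P]_(w in unbounded_from 0) `|(D n w)%:E - (z (Y 0 w))%:E|)%E @ \oo --> 0%E &
   (fun n => \int[P]_(w in unbounded_from 0) (D n w)%:E)%E @ \oo -->
     (\int[P]_(w in unbounded_from 0) (z (Y 0 w))%:E)%E].
  apply: (@dominated_convergence _ _ _ P _ mA (fun n w => (D n w)%:E) _
    (fun w => `|(z (Y 0 w))%:E|)%E).
  - by move=> n; exact: discrete_measurable_fun.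
  - by apply: discrete_measurable_fun; exact: discrete_z.
  - apply: aeW => w; rewrite unbounded_from01 => Aw.
    apply: cvg_near_cst.
    have [n _ /= Hn] := Aw (Num.trunc `|z (Y 0 w)|).+1 I.
    exists n => // m /= nm; congr (_%:E); rewrite /D max_r //.
    have := max_sum_segment_homo 1 w nm; have := truncnS_gt `|z (Y 0 w)|.
    have := ler_norm (- z (Y 0 w)); rewrite normrN /=; lra.
  - by apply: sA; apply: integrable_abse; exact: integrable_z.
  - apply: aeW => w n _; rewrite /= lee_fin.
    have := max_sum_ge0 (segment 1 n w); rewrite /D.
    have := ler_norm (- z (Y 0 w)); rewrite normrN; have := ler_norm (z (Y 0 w)).
    move=> h1 h2 h3; rewrite ler_norml; case: (leP (- max_sum (segment 1 n w))); lra.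
by apply: (cvge_ge _ cv); exact: nearW.
Qed.

Lemma negative_drift_bounded :
  (\int[P]_w (z (Y 0 w))%:E < 0)%E -> P (unbounded_from 0) = 0%E.
Proof.
move=> neg; have mA := measurable_unbounded_from 0.
set a := fine (P (unbounded_from 0)).
have : (\int[P]_(w in unbounded_from 0) (z (Y 0 w))%:E =
    a%:E * \int[P]_w (z (Y 0 w))%:E)%E.
  have h (g : U -> \bar R) : (forall u, 0 <= g u)%E ->
      (\int[P]_(w in unbounded_from 0) g (Y 0 w) = a%:E * \int[P]_w g (Y 0 w))%E.
    move=> g0; apply: discrete_integral_eq => //.
    by move=> u; rewrite /a unbounded_from01; exact: prob_head_unbounded.
  rewrite integralE [in RHS]integralE.
  have hp : (\int[P]_(w in unbounded_from 0) (fun w => (z (Y 0 w))%:E)^\+ w =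
      a%:E * \int[P]_w (fun w => (z (Y 0 w))%:E)^\+ w)%E.
    under eq_integral do rewrite funeposE; under [in RHS]eq_integral do rewrite funeposE.
    by apply: (h (fun u => maxe (z u)%:E 0)%E) => u; rewrite le_max lexx orbT.
  have hn : (\int[P]_(w in unbounded_from 0) (fun w => (z (Y 0 w))%:E)^\- w =
      a%:E * \int[P]_w (fun w => (z (Y 0 w))%:E)^\- w)%E.
    under eq_integral do rewrite funenegE; under [in RHS]eq_integral do rewrite funenegE.
    by apply: (h (fun u => maxe (- (z u)%:E) 0)%E) => u; rewrite le_max lexx orbT.
  rewrite hp hn.
  rewrite [RHS]muleBr //.
  apply: fin_num_adde_defl; rewrite fin_numN.
  apply: integrable_fin_num => //; exact: integrable_funeneg.
move=> E; have := integral_unbounded_ge0; rewrite E.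
rewrite -(prob_fineK P mA) -/a.
have a0 : 0 <= a by exact: prob_fine_ge0.
have /fineK <- : (\int[P]_w (z (Y 0 w))%:E)%E \is a fin_num by exact: integrable_fin_num.
move: neg; have /fineK <- : (\int[P]_w (z (Y 0 w))%:E)%E \is a fin_num by exact: integrable_fin_num.
rewrite lte_fin -EFinM lee_fin => m0 am; congr (_%:E).
by nra.
Qed.

Lemma negative_drift_sum_bounded : (\int[P]_w (z (Y 0 w))%:E < 0)%E ->
  {ae P, forall w, exists K, forall n, \sum_(0 <= i < n) z (Y i w) <= K}.
Proof.
move=> neg; have mA := measurable_unbounded_from 0.
exists (unbounded_from 0); split => //; first exact: negative_drift_bounded.
move=> w; apply: contra_notP => Aw.
have /existsNP[K /not_implyP[_ H]] := Aw.
exists K%:R => n.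
apply: le_trans (_ : max_sum (segment 0 n w) <= _).
  by apply: le_trans (sum_le_max_sum _); rewrite big_map /index_iota subn0.
apply: ltW; rewrite ltNge; apply/negP => h; apply: H.
by exists n.
Qed.

End maximal.

Lemma slln_upper (g : U -> R) (m e : R) :
  P.-integrable setT (fun w => (g (Y 0 w))%:E) ->
  (\int[P]_w (g (Y 0 w))%:E = m%:E)%E -> 0 < e ->
  {ae P, forall w, exists N, forall n, (N <= n)%N ->
     (\sum_(0 <= i < n) g (Y i w)) / n%:R <= m + e}.
Proof.
move=> ig gm e0.
pose z u := g u - (m + e / 2).
have iz : P.-integrable setT (fun w => (z (Y 0 w))%:E).
  rewrite /z; under eq_fun do rewrite EFinB.
  apply: integrableB => //; exact: finite_measure_integrable_cst.
have zneg : (\int[P]_w (z (Y 0 w))%:E < 0)%E.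
  rewrite /z; under eq_integral do rewrite EFinB.
  rewrite integralB_EFin //; last exact: finite_measure_integrable_cst.
  have -> : (\int[P]_w (m + e / 2)%:E = (m + e / 2)%:E)%E.
    by rewrite (integral_cst P measurableT) [X in (_ * X)%E]probability_setT mule1.
  rewrite gm -EFinB lte_fin; lra.
apply: filterS (negative_drift_sum_bounded iz zneg) => w [K HK].
exists (Num.trunc (`|K| * 2 / e)).+1 => n Nn.
have n0 : 0 < n%:R :> R by rewrite ltr0n; lia.
rewrite ler_pdivrMr //.
have := HK n; rewrite /z sumrB sumr_const_nat subn0 -mulr_natr => h.
have h2 : `|K| * 2 / e < n%:R.
  by apply: lt_le_trans (truncnS_gt _) _; rewrite ler_nat.
rewrite ltr_pdivrMr // in h2.
have := ler_norm K; nra.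
Qed.

Lemma slln (g : U -> R) (m : R) :
  P.-integrable setT (fun w => (g (Y 0 w))%:E) ->
  (\int[P]_w (g (Y 0 w))%:E = m%:E)%E ->
  {ae P, forall w, (fun n => (\sum_(0 <= i < n) g (Y i w)) / n%:R) @ \oo --> m}.
Proof.
move=> ig gm.
have up : {ae P, forall w, forall k, exists N, forall n, (N <= n)%N ->
     (\sum_(0 <= i < n) g (Y i w)) / n%:R <= m + k.+1%:R^-1}.
  by apply: ae_foralln => k; apply: slln_upper.
have lo : {ae P, forall w, forall k, exists N, forall n, (N <= n)%N ->
     (\sum_(0 <= i < n) - g (Y i w)) / n%:R <= - m + k.+1%:R^-1}.
  apply: ae_foralln => k; apply: (@slln_upper (fun u => - g u)) => //.
    by under eq_fun do rewrite EFinN; exact: integrableN.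
  under eq_integral do rewrite EFinN.
  by rewrite integralN ?gm //; apply: integrable_add_def.
apply: filterS2 up lo => w up lo.
apply/cvgrPdist_le => e e0.
have [k ke] : exists k, k.+1%:R^-1 <= e.
  exists (Num.trunc e^-1); rewrite -[leRHS]invrK lef_pV2 ?posrE ?invr_gt0 //.
  by apply: ltW; exact: truncnS_gt.
have [N1 H1] := up k; have [N2 H2] := lo k.
exists (N1 + N2)%N => // n /= Nn.
have h1 : (\sum_(0 <= i < n) g (Y i w)) / n%:R <= m + e.
  by apply: le_trans (H1 n _) _; [lia|rewrite lerD2l].
have h2 : (\sum_(0 <= i < n) - g (Y i w)) / n%:R <= - m + e.
  by apply: le_trans (H2 n _) _; [lia|rewrite lerD2l].
rewrite sumrN mulNr in h2; rewrite ler_norml; lra.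
Qed.

End iid_sequences.

(** * Positive recurrence *)

Section drift.
Context {d : measure_display} {T : measurableType d} {R : realType}.
Variable P : probability T R.
Variables (S : set R) (X : nat -> T -> R) (F : nat -> set (set T)) (c s2 p : R).

Lemma le_integral_fibers (U : Type) (f : T -> U) (A : set T) (g h : T -> R) :
  discrete_rv f -> measurable A -> discrete_rv g -> discrete_rv h ->
  (forall w, 0 <= g w) -> (forall w, 0 <= h w) ->
  (forall u, \int[P]_(w in A `&` [set w | f w = u]) (g w)%:E <=
             \int[P]_(w in A `&` [set w | f w = u]) (h w)%:E)%E ->
  (\int[P]_(w in A) (g w)%:E <= \int[P]_(w in A) (h w)%:E)%E.
Proof.
move=> df mA dg dh g0 h0 gh.
have /countable_injP[k kinj] := df.1.
pose B n := A `&` [set w | k (f w) = n].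
have mB n : measurable (B n).
  by apply: measurableI => //; exact: (discrete_measurable (fun u => k u = n) df).
have AB : A = \bigcup_n B n.
  by apply/seteqP; split=> [w Aw|w [n _ []//]]; exists (k (f w)).
have tB : trivIset setT B.
  by apply/trivIsetP => i j _ _; apply: contraNeq => /set0P[w [[_ <-] [_ <-]]].
have mE (D : set T) (g' : T -> R) : discrete_rv g' -> measurable_fun D (fun w => (g' w)%:E).
  move=> dg'; apply: discrete_measurable_fun.
  exact: (@discrete_comp _ _ _ _ g' (fun r => r%:E)).
rewrite AB !ge0_integral_bigcup //; try exact: mE.
- apply: lee_nneseries => [n _ _|n _]; first by apply: integral_ge0 => w _; rewrite lee_fin.
  have [[w [Aw kw]]|nB] := pselect (B n !=set0); last first.
    by rewrite (_ : B n = set0) ?integral_set0 //; apply/eqP/negPn/negP => /set0P.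
  rewrite (_ : B n = A `&` [set w' | f w' = f w]) //.
  apply/seteqP; split => v [Av /= kv]; split => //=; last by rewrite kv.
  by apply: kinj; rewrite ?inE; [exists v|exists w|rewrite kv kw].
- by move=> w _; rewrite lee_fin.
- by move=> w _; rewrite lee_fin.
Qed.

Hypothesis hA0 : A0 P S X F.

Lemma countable_S : countable S.
Proof.
have [_ _ Sfin _ _] := hA0.
apply: (@sub_countable _ _ _ (\bigcup_n [set x | S x /\ x <= n%:R])).
  apply: subset_card_le => x Sx; exists (Num.trunc `|x|).+1 => //; split => //.
  by apply: ltW; apply: le_lt_trans (ler_norm _) (truncnS_gt _).
by apply: bigcup_countable => // n _; exact/finite_set_countable/Sfin.
Qed.

Lemma X_in_S t w : (0 < t)%N -> S (X t w).
Proof. by have [_ _ _ _ [_ _ H _ _]] := hA0; exact: H. Qed.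

Lemma X_ge0 t w : (0 < t)%N -> 0 <= X t w.
Proof. by have [_ H _ _ _] := hA0; move=> t0; apply: H; exact: X_in_S. Qed.

Lemma F_measurable t A : (0 < t)%N -> F t A -> measurable A.
Proof. by have [_ _ _ _ [H _ _ _ _]] := hA0; move=> /H[_]; apply. Qed.

Lemma F_sigmaE t : (0 < t)%N -> (F t).-sigma.-measurable = F t.
Proof.
have [_ _ _ _ [H _ _ _ _]] := hA0.
by move=> /H[/measurable_g_measurableTypeE].
Qed.

(* Sets in [F s] are handled as the measurable sets of the space [T] with sigma-algebra [F s]. *)
Lemma discrete_X_adapted t s : (0 < t)%N -> (t <= s)%N ->
  discrete_rv (X t : g_sigma_algebraType (F s) -> R).
Proof.
have [_ _ _ _ [_ Fmono _ FX _]] := hA0.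
move=> t0 ts; have s0 : (0 < s)%N by exact: leq_trans ts.
have cX : countable (range (X t)).
  apply: sub_countable countable_S; apply: subset_card_le => _ [w _ <-].
  exact: X_in_S.
split => // B.
rewrite (_ : _ @^-1` B = \bigcup_(y in range (X t) `&` B) [set w | X t w = y]); last first.
  by apply/seteqP; split => w /=; [move=> Bw; exists (X t w)|move=> [y [_ By] /= ->]].
apply: countable_bigcup_measurable => [|y _].
  by apply: sub_countable cX; apply: subset_card_le => ? [].
by rewrite F_sigmaE //; apply: (Fmono t) => //; exact: FX.
Qed.

Lemma discrete_of_adapted (U : Type) t (f : T -> U) : (0 < t)%N ->
  discrete_rv (f : g_sigma_algebraType (F t) -> U) -> discrete_rv f.
Proof.
move=> t0 [cf mf]; split => // B; apply: (F_measurable t0).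
by rewrite -F_sigmaE //; exact: mf.
Qed.

Lemma discrete_X t : (0 < t)%N -> discrete_rv (X t).
Proof. by move=> t0; apply: (discrete_of_adapted t0); exact: discrete_X_adapted. Qed.

Lemma F_event (U : Type) t (f : T -> U) (B : set U) : (0 < t)%N ->
  discrete_rv (f : g_sigma_algebraType (F t) -> U) -> F t [set w | B (f w)].
Proof. by move=> t0 df; rewrite -F_sigmaE //; exact: (discrete_measurable B df). Qed.

Lemma F_setI t A B : (0 < t)%N -> F t A -> F t B -> F t (A `&` B).
Proof. by move=> t0; rewrite -F_sigmaE //; exact: measurableI. Qed.

Definition no_zero (t s : nat) : set T :=
  [set w | all (fun y => y != 0) [seq X u w | u <- iota t.+1 (s - t)]].

Lemma no_zeroP t s w :
  no_zero t s w <-> forall u, (t < u)%N -> (u <= s)%N -> X u w <> 0.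
Proof.
rewrite /no_zero /= all_map; split.
  by move=> /allP H u tu us; apply/eqP/H; rewrite mem_iota; lia.
by move=> H; apply/allP => u; rewrite mem_iota => hu /=; apply/eqP/H; lia.
Qed.

Lemma F_no_zero t s : (0 < t)%N -> (t <= s)%N -> F s (no_zero t s).
Proof.
move=> t0 ts; have s0 : (0 < s)%N by exact: leq_trans ts.
apply: (F_event (f := fun w => [seq X u w | u <- iota t.+1 (s - t)])
  (fun l => all (fun y => y != 0) l)) => //.
apply: discrete_seq => u; rewrite mem_iota => hu.
by apply: discrete_X_adapted; lia.
Qed.

Lemma measurable_no_zero t s : measurable (no_zero t s).
Proof.
apply: (discrete_measurable (f := fun w => [seq X u w | u <- iota t.+1 (s - t)])
  (fun l => all (fun y => y != 0) l)).
apply: discrete_seq => u; rewrite mem_iota => hu.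
by apply: discrete_X; lia.
Qed.

Lemma subset_no_zero t s s' : (s <= s')%N -> no_zero t s' `<=` no_zero t s.
Proof. by move=> ss w /no_zeroP H; apply/no_zeroP => u tu us; apply: H => //; lia. Qed.

Hypothesis hMp : Mp P X F p.
Hypothesis p_ge2 : 2 <= p.

Lemma discrete_Delta t : (0 < t)%N -> discrete_rv (Delta X t).
Proof.
move=> t0; apply: (@discrete_comp2 _ _ _ _ _ (X t.+1) (X t) (fun a b => a - b));
  exact: discrete_X.
Qed.

Lemma sqr_le_powR (y : R) : y ^+ 2 <= 1 + `|y| `^ p.
Proof.
rewrite -real_normK ?num_real //; set a := `|y|.
have a0 : 0 <= a by exact: normr_ge0.
have [a1|/ltW a1] := lerP a 1.
  have : a ^+ 2 <= 1 by rewrite exprn_ile1.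
  have := powR_ge0 a p; lra.
by rewrite -powR_mulrn // ler_wpDl // ler_powR.
Qed.

Lemma second_moment_bound : exists2 K : R -> R, {homo K : x y / x <= y} &
  forall t A x, (0 < t)%N -> F t A -> A `<=` [set w | X t w = x] ->
    (\int[P]_(w in A) ((Delta X t w) ^+ 2)%:E <= (K x * fine (P A))%:E)%E.
Proof.
have [dl [C [dl0 H]]] := hMp.
pose K (x : R) : R := 1 + `|C| * (1 + `|Num.max 0 x|) `^ `|p - 2 - dl|.
exists K.
  move=> x y xy; rewrite lerD2l ler_wpM2l // ge0_ler_powR ?nnegrE ?addr_ge0 //.
  have m0 (z : R) : 0 <= Num.max 0 z by rewrite le_max lexx.
  by rewrite lerD2l !ger0_norm // ge_max m0 le_max xy orbT.
move=> t A x t0 FA Ax.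
have mA := F_measurable t0 FA.
have dD := discrete_Delta t0.
have mf (D : set T) (h : R -> R) : measurable_fun D (fun w => (h (Delta X t w))%:E).
  apply: discrete_measurable_fun; exact: (@discrete_comp _ _ _ _ _ (fun r => (h r)%:E) dD).
have -> : (K x * fine (P A))%:E = (\int[P]_(w in A) (K x)%:E)%E.
  by rewrite integral_cst // EFinM prob_fineK.
apply: (@le_trans _ _ (\int[P]_(w in A) (1%:E + (`|Delta X t w| `^ p)%:E))%E).
  apply: ge0_le_integral => //.
  - by move=> w _; rewrite lee_fin sqr_ge0.
  - exact: (mf _ (fun r => r ^+ 2)).
  - exact: (mf _ (fun r => 1 + `|r| `^ p)).
  - by move=> w _; rewrite -EFinD lee_fin sqr_le_powR.
rewrite ge0_integralD //; last exact: (mf _ (fun r => `|r| `^ p)).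
have -> : (\int[P]_(w in A) (K x)%:E = \int[P]_(w in A) 1%:E +
    \int[P]_(w in A) (`|C| * (1 + `|Num.max 0 x|) `^ `|p - 2 - dl|)%:E)%E.
  by rewrite -ge0_integralD // => w _; rewrite lee_fin mulr_ge0 // powR_ge0.
rewrite leeD2l //; apply: le_trans (H t t0 A FA) _.
have [->|/set0P[w0 Aw0]] := eqVneq A set0; first by rewrite !integral_set0.
have x0 : 0 <= x by rewrite -(Ax _ Aw0); exact: X_ge0.
rewrite (eq_integral (cst (C * (1 + x) `^ (p - 2 - dl))%:E)); last first.
  by move=> w; rewrite inE => /Ax /= ->.
rewrite !integral_cst // lee_wpmul2r // lee_fin.
apply: (@le_trans _ _ (`|C| * (1 + x) `^ (p - 2 - dl))).
  by rewrite ler_wpM2r ?powR_ge0 // ler_norm.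
rewrite ler_wpM2l // max_r // ger0_norm // ler_powR ?ler_norm //; lra.
Qed.

Hypothesis hA2 : A2 P X F c s2.
Hypothesis r_gt1 : 1 < - (2 * c) / s2.

(* Lyapunov function [x^2]: its drift [2 c + s2] at infinity is negative since [r > 1]. *)
Lemma drift_fiber : exists x1 L kap : R, [/\ 0 < kap, 0 <= L &
  forall t A x, (0 < t)%N -> F t A -> A `<=` [set w | X t w = x] ->
    (\int[P]_(w in A) ((X t.+1 w) ^+ 2 + kap)%:E <=
     \int[P]_(w in A) ((X t w) ^+ 2 + L * (X t w < x1)%R%:R)%:E)%E].
Proof.
have [K Kmono HK] := second_moment_bound.
have [s20 HA2] := hA2.
have neg : 2 * c + s2 < 0.
  by move: r_gt1; rewrite ltr_pdivlMr //; lra.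
pose kap := - (2 * c + s2) / 2.
have kap0 : 0 < kap by rewrite divr_gt0 //; lra.
have [x0 [x01 Hx0]] := HA2 (kap / 3) ltac:(by rewrite divr_gt0).
pose x1 := Num.max x0 (expR 1).
pose L : R := 2 * x1 ^+ 2 + 2 * `|K x1| + kap.
have L0 : 0 <= L.
  have := sqr_ge0 x1; have := normr_ge0 (K x1); rewrite /L; lra.
exists x1, L, kap; split => // t A x t0 FA Ax.
have mA := F_measurable t0 FA.
have dD := discrete_Delta t0.
have [->|/set0P[w0 Aw0]] := eqVneq A set0; first by rewrite !integral_set0.
have xge0 : 0 <= x by rewrite -(Ax _ Aw0); exact: X_ge0.
set a := fine (P A).
have a0 : 0 <= a by exact: prob_fine_ge0.
have aE : a%:E = P A by exact: prob_fineK.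
have mf (D : set T) (h : R -> R) : measurable_fun D (fun w => (h (Delta X t w))%:E).
  apply: discrete_measurable_fun; exact: (@discrete_comp _ _ _ _ _ (fun r => (h r)%:E) dD).
have m2lt := HK t A x t0 FA Ax.
have i2 : P.-integrable A (EFin \o (fun w => Delta X t w ^+ 2)).
  apply/integrableP; split; first exact: (mf _ (fun r => r ^+ 2)).
  apply: le_lt_trans (ltry (K x * a)); apply: le_trans m2lt.
  rewrite le_eqVlt; apply/orP; left; apply/eqP; apply: eq_integral => w _ /=.
  by rewrite ger0_norm // sqr_ge0.
have icst r : P.-integrable A (EFin \o cst r : T -> \bar R) by exact: finite_measure_integrable_cst.
have i1 : P.-integrable A (EFin \o Delta X t).
  apply: (@le_integrable _ _ _ P _ mA _ (EFin \o (fun w => 1 + Delta X t w ^+ 2))).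
  - exact: (mf _ (fun r => r)).
  - move=> w _ /=; rewrite lee_fin [leRHS]ger0_norm; last by rewrite addr_ge0 // sqr_ge0.
    rewrite ler_norml; nra.
  - rewrite (_ : _ \o _ = (fun w => 1%:E + (Delta X t w ^+ 2)%:E)%E) //.
    by apply: integrableD => //; exact: (icst 1).
set m1 := fine (\int[P]_(w in A) (Delta X t w)%:E).
set m2 := fine (\int[P]_(w in A) (Delta X t w ^+ 2)%:E).
have m1E : m1%:E = (\int[P]_(w in A) (Delta X t w)%:E)%E.
  by rewrite fineK //; exact: integrable_fin_num.
have m2E : m2%:E = (\int[P]_(w in A) (Delta X t w ^+ 2)%:E)%E.
  by rewrite fineK //; exact: integrable_fin_num.
have lhs : (\int[P]_(w in A) ((X t.+1 w) ^+ 2 + kap)%:E =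
    (x ^+ 2 * a + kap * a + 2 * x * m1 + m2)%:E)%E.
  have -> : (\int[P]_(w in A) ((X t.+1 w) ^+ 2 + kap)%:E = \int[P]_(w in A)
      ((x ^+ 2 + kap)%:E + ((2 * x)%:E * (Delta X t w)%:E + (Delta X t w ^+ 2)%:E)))%E.
    apply: eq_integral => w; rewrite inE => /Ax /= Xx.
    rewrite -EFinM -!EFinD; congr (_%:E); rewrite /Delta Xx; ring.
  have i1' : P.-integrable A (fun w => (2 * x)%:E * (Delta X t w)%:E)%E by exact: integrableZl.
  rewrite integralD //; [|exact: (icst (x ^+ 2 + kap))|by apply: integrableD].
  rewrite integralD // integralZl // integral_cst_fine // -/a -m1E -m2E -!EFinM -!EFinD.
  congr (_%:E); ring.
have rhs : (\int[P]_(w in A) ((X t w) ^+ 2 + L * (X t w < x1)%R%:R)%:E =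
    ((x ^+ 2 + L * (x < x1)%R%:R) * a)%:E)%E.
  rewrite (eq_integral (fun=> (x ^+ 2 + L * (x < x1)%R%:R)%:E)); last first.
    by move=> w; rewrite inE => /Ax /= ->.
  by rewrite integral_cst_fine.
rewrite lhs rhs lee_fin.
have [xx1|x1x] := ltP x x1; rewrite ?mulr1 ?mulr0.
  have m2K : m2 <= K x1 * a.
    rewrite -lee_fin m2E; apply: le_trans m2lt _.
    by rewrite lee_fin ler_wpM2r // Kmono // ltW.
  have m2K' : m2 <= `|K x1| * a by apply: le_trans m2K _; rewrite ler_wpM2r // ler_norm.
  have xm1 : 2 * x * m1 <= x ^+ 2 * a + m2.
    have : (0 <= \int[P]_(w in A) ((x - Delta X t w) ^+ 2)%:E)%E.
      by apply: integral_ge0 => w _; rewrite lee_fin sqr_ge0.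
    have -> : (\int[P]_(w in A) ((x - Delta X t w) ^+ 2)%:E = \int[P]_(w in A)
      ((x ^+ 2)%:E + ((- (2 * x))%:E * (Delta X t w)%:E + (Delta X t w ^+ 2)%:E)))%E.
      apply: eq_integral => w _; rewrite -EFinM -!EFinD; congr (_%:E); ring.
    have i1' : P.-integrable A (fun w => (- (2 * x))%:E * (Delta X t w)%:E)%E.
      exact: integrableZl.
    rewrite integralD //; [|exact: (icst (x ^+ 2))|by apply: integrableD].
    rewrite integralD // integralZl // integral_cst_fine // -/a -m1E -m2E -!EFinM -!EFinD lee_fin.
    lra.
  have x2 : x ^+ 2 * a <= x1 ^+ 2 * a by rewrite ler_wpM2r // ler_pXn2r ?nnegrE ?(ltW xx1) //; lra.
  have a1 : 0 <= x ^+ 2 * a by rewrite mulr_ge0 // sqr_ge0.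
  rewrite /L; nra.
have x0x : x0 <= x by apply: le_trans x1x; rewrite le_max lexx.
have ex : expR 1 <= x by apply: le_trans x1x; rewrite le_max lexx orbT.
have x_gt0 : 0 < x by lra.
have lnx : 1 <= ln x by rewrite -(expRK 1) ler_ln ?posrE ?expR_gt0.
have AE : A `<=` [set w | x0 <= X t w] by move=> w /Ax /= ->.
have [h1 h2] := Hx0 t t0.
have [_ {}h1] := h1 A FA AE i1.
have [_ {}h2] := h2 A FA AE i2.
have {}h1 : m1 <= (c / x + kap / 3 / (x * ln x)) * a.
  rewrite -lee_fin m1E; apply: le_trans h1 _.
  rewrite (eq_integral (fun=> (c / x + kap / 3 / (x * ln x))%:E)); last first.
    by move=> w; rewrite inE => /Ax /= ->.
  by rewrite integral_cst_fine.
have {}h2 : m2 <= (s2 + kap / 3 / ln x) * a.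
  rewrite -lee_fin m2E; apply: le_trans h2 _.
  rewrite (eq_integral (fun=> (s2 + kap / 3 / ln x)%:E)); last first.
    by move=> w; rewrite inE => /Ax /= ->.
  by rewrite integral_cst_fine.
have {}h1 : x * m1 <= (c + kap / 3 / ln x) * a.
  have -> : (c + kap / 3 / ln x) * a = x * ((c / x + kap / 3 / (x * ln x)) * a).
    by field; rewrite !gt_eqF //; lra.
  by rewrite ler_pM2l.
have kl : kap / 3 / ln x <= kap / 3 by rewrite ler_pdivrMr ?ler_peMr //; lra.
have kla : kap / 3 / ln x * a <= kap / 3 * a by rewrite ler_wpM2r.
have kE : kap * 2 = - (2 * c + s2) by rewrite /kap; field.
have kEa : kap * 2 * a = - (2 * c + s2) * a by rewrite kE.
nra.
Qed.

Lemma drift_event : exists x1 L kap : R, [/\ 0 < kap, 0 <= L &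
  forall t A, (0 < t)%N -> F t A ->
    (\int[P]_(w in A) ((X t.+1 w) ^+ 2)%:E + kap%:E * P A <=
     \int[P]_(w in A) ((X t w) ^+ 2)%:E + L%:E * P (A `&` [set w | (X t w < x1)%R]))%E].
Proof.
have [x1 [L [kap [kap0 L0 H]]]] := drift_fiber.
exists x1, L, kap; split => // t A t0 FA.
have mA := F_measurable t0 FA.
have dX := discrete_X t0.
have dX' : discrete_rv (X t.+1) by exact: discrete_X.
have mf (g : R -> R) u (D : set T) : (0 < u)%N -> measurable_fun D (fun w => (g (X u w))%:E).
  move=> u0; apply: discrete_measurable_fun.
  by apply: (@discrete_comp _ _ _ _ (X u) (fun r => (g r)%:E)); exact: discrete_X.
have mB : measurable [set w | X t w < x1] by exact: (discrete_measurable (fun r => r < x1) dX).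
have -> : (\int[P]_(w in A) ((X t.+1 w) ^+ 2)%:E + kap%:E * P A =
    \int[P]_(w in A) ((X t.+1 w) ^+ 2 + kap)%:E)%E.
  under [in RHS]eq_integral do rewrite EFinD.
  rewrite ge0_integralD //.
  - by rewrite integral_cst.
  - by move=> w _; rewrite lee_fin sqr_ge0.
  - exact: (mf (fun r => r ^+ 2)).
  - by move=> w _; rewrite lee_fin ltW.
have -> : (\int[P]_(w in A) ((X t w) ^+ 2)%:E + L%:E * P (A `&` [set w | (X t w < x1)%R]) =
    \int[P]_(w in A) ((X t w) ^+ 2 + L * (X t w < x1)%R%:R)%:E)%E.
  under [in RHS]eq_integral do rewrite EFinD (EFinM L).
  rewrite ge0_integralD //; last 4 first.
  - by move=> w _; rewrite lee_fin sqr_ge0.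
  - exact: (mf (fun r => r ^+ 2)).
  - by move=> w _; rewrite lee_fin mulr_ge0.
  - exact: (mf (fun r => L * (r < x1)%R%:R)).
  rewrite ge0_integralZl //; last exact: (mf (fun r => (r < x1)%R%:R)).
  congr (_ + _ * _)%E; rewrite setIC -(integral_indic P mA) //.
  apply: eq_integral => w _; rewrite indicE; congr ((nat_of_bool _)%:R%:E).
  by apply/idP/idP; rewrite inE.
apply: (le_integral_fibers (f := X t)) => //.
- exact: (@discrete_comp _ _ _ _ (X t.+1) (fun r => r ^+ 2 + kap)).
- exact: (@discrete_comp _ _ _ _ (X t) (fun r => r ^+ 2 + L * (r < x1)%R%:R)).
- by move=> w; rewrite addr_ge0 ?sqr_ge0 ?ltW.
- by move=> w; rewrite addr_ge0 ?sqr_ge0 ?mulr_ge0.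
move=> x; apply: (H t _ x) => //.
apply: F_setI => //; apply: (F_event (f := X t) (fun r => r = x)) => //.
exact: discrete_X_adapted.
Qed.

Hypothesis hA1 : A1 P S X F.

Lemma finite_hitting_bounds (x1 : R) : exists (M : nat) (phi0 : R), 0 < phi0 /\
  forall t A, (0 < t)%N -> F t A -> A `<=` [set w | X t w < x1] ->
    (phi0%:E * P A <= P (A `\` no_zero t (t + M)))%E.
Proof.
have [S0 Sge0 Sfin _ _] := hA0.
have [m [phi [mphi H]]] := hA1.
have /finite_seqP[s sE] := Sfin x1.
have [M [phi0 [phi00 HM]]] : exists (M : nat) (phi0 : R), 0 < phi0 /\
    forall x, x \in s -> (m x 0%R <= M)%N /\ phi0 <= phi x 0%R.
  have : forall x, x \in s -> S x.
    by move=> x xs; have [] : [set x | S x /\ x <= x1] x by rewrite sE.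
  elim: (s) => [|y l IH] Hl; first by exists 0%N, 1; split.
  have [|M [phi0 [phi00 HM]]] := IH.
    by move=> x xl; apply: Hl; rewrite in_cons xl orbT.
  have Sy : S y by apply: Hl; rewrite mem_head.
  exists (maxn M (m y 0%R)), (Num.min phi0 (phi y 0%R)); split.
    by rewrite lt_min phi00; have [_ ->] := mphi y 0 Sy S0.
  move=> x; rewrite in_cons => /orP[/eqP ->|/HM[h1 h2]].
    by rewrite leq_maxr ge_min lexx orbT.
  by rewrite leq_max h1 ge_min h2.
exists M, phi0; split => // t A t0 FA Ax.
have mA := F_measurable t0 FA.
have Xs w : A w -> X t w \in s.
  move=> Aw; have : [set x | S x /\ x <= x1] (X t w).
    by split; [exact: X_in_S|apply: ltW; exact: Ax].
  by rewrite sE.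
have dhit : discrete_rv (fun w => X (t + m (X t w) 0%R)%N w).
  apply: (@discrete_bind _ _ _ _ (X t) (fun x w => X (t + m x 0%R)%N w)).
    exact: discrete_X.
  by move=> x; apply: discrete_X; lia.
apply: (@le_trans _ _ (\int[P]_(w in A) (phi (X t w) 0%R)%:E)%E).
  rewrite -integral_cst //; apply: ge0_le_integral => //.
  - by move=> w _; rewrite lee_fin ltW.
  - apply: discrete_measurable_fun.
    by apply: (@discrete_comp _ _ _ _ (X t) (fun r => (phi r 0%R)%:E)); exact: discrete_X.
  - by move=> w /Xs/HM[_]; rewrite lee_fin.
apply: le_trans (H t 0 t0 S0 A FA) _.
apply: le_measure.
- by rewrite inE; apply: measurableI => //; exact: (discrete_measurable (fun r => r = 0%R) dhit).
- by rewrite inE; apply: measurableD => //; exact: measurable_no_zero.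
- move=> w [Aw /= Xw]; split => // /no_zeroP; apply; last exact: Xw.
    have [] := mphi (X t w) 0 (X_in_S w t0) S0; lia.
  by have [] := HM _ (Xs _ Aw); lia.
Qed.

Lemma sum_shift_diff_le (q : nat -> R) M n : (forall i, 0 <= q i <= 1) ->
  \sum_(0 <= i < n) (q i - q (i + M)%N) <= M%:R.
Proof.
move=> q01; elim: M => [|M IH].
  by rewrite big1 // => i _; rewrite addn0 subrr.
rewrite (eq_bigr (fun i => (q i - q (i + M)%N) + (q (i + M)%N - q (i + M.+1)%N))); last first.
  by move=> i _; rewrite addrA subrK.
rewrite big_split /= -natr1; apply: lerD => //.
rewrite (eq_bigr (fun i => - (q (i.+1 + M)%N - q (i + M)%N))); last first.
  by move=> i _; rewrite opprB addnS addSn.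
rewrite sumrN (telescope_sumr (fun i => q (i + M)%N)) //.
have := q01 (0 + M)%N; have := q01 (n + M)%N; lra.
Qed.

Lemma second_moment_finite t : (0 < t)%N -> (\int[P]_w ((X t w) ^+ 2)%:E < +oo)%E.
Proof.
have [x1 [L [kap [kap0 L0 H]]]] := drift_event.
have [_ _ _ _ [_ _ _ FX X1]] := hA0.
case: t => // t _; elim: t => [|t IH].
  rewrite (ae_eq_integral (cst 0%E)) ?integral0 //.
  - apply: discrete_measurable_fun.
    by apply: (@discrete_comp _ _ _ _ (X 1) (fun r => (r ^+ 2)%:E)); exact: discrete_X.
  have mE : measurable [set w | X 1 w = 0] by apply: (@F_measurable 1) => //; exact: FX.
  exists (~` [set w | X 1 w = 0]); split; first exact: measurableC.
    by apply: (etrans (probability_setC P mE)); rewrite X1 subee.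
  by move=> w /=; apply: contra_not => -> _; rewrite expr0n.
have FT : F t.+1 setT.
  by rewrite -F_sigmaE //; exact: measurableT.
have := H t.+1 setT isT FT; rewrite setTI => h.
apply: le_lt_trans (_ : _ <= \int[P]_w (X t.+1 w ^+ 2)%:E +
    L%:E * P [set w | (X t.+1 w < x1)%R])%E _.
  by apply: le_trans h; rewrite leeDl // mule_ge0 // lee_fin ltW.
rewrite lte_add_pinfty // -prob_fineK ?ltry //.
by apply: (discrete_measurable (fun r => r < x1)); exact: discrete_X.
Qed.

(* The visits to the bounded set [{x < x1}] before the first zero after [t] are summable in
   probability, because each of them ends the excursion within [M] steps with probability
   at least [phi0]; the Lyapunov drift controls the time spent outside. *)
Lemma sum_no_zero_bounded t : (0 < t)%N -> exists B : R, forall n,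
  \sum_(0 <= i < n) fine (P (no_zero t (t + i))) <= B.
Proof.
move=> t0.
have [x1 [L [kap [kap0 L0 H]]]] := drift_event.
have [M [phi0 [phi00 HM]]] := finite_hitting_bounds x1.
pose q i := fine (P (no_zero t (t + i))).
pose A i := no_zero t (t + i) `&` [set w | X (t + i)%N w < x1].
pose a i := fine (P (A i)).
pose v i := fine (\int[P]_(w in no_zero t (t + i)) ((X (t + i)%N w) ^+ 2)%:E).
have ti i : (0 < t + i)%N by lia.
have FG i : F (t + i) (no_zero t (t + i)) by apply: F_no_zero => //; exact: leq_addr.
have mG i : measurable (no_zero t (t + i)) by exact: (F_measurable (ti i)).
have FA i : F (t + i) (A i).
  apply: F_setI => //; apply: (F_event (f := X (t + i)) (fun r => r < x1)) => //.
  exact: discrete_X_adapted.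
have mA i : measurable (A i) by exact: (F_measurable (ti i)).
have q01 i : 0 <= q i <= 1 by rewrite prob_fine_ge0 prob_fine_le1.
have mX2 u (D : set T) : (0 < u)%N -> measurable_fun D (fun w => (X u w ^+ 2)%:E).
  move=> u0; apply: discrete_measurable_fun.
  by apply: (@discrete_comp _ _ _ _ (X u) (fun r => (r ^+ 2)%:E)); exact: discrete_X.
have vfin u (D : set T) : (0 < u)%N -> measurable D ->
    (\int[P]_(w in D) ((X u w) ^+ 2)%:E)%E \is a fin_num.
  move=> u0 mD; rewrite ge0_fin_numE; last by apply: integral_ge0 => w _; rewrite lee_fin sqr_ge0.
  apply: le_lt_trans (second_moment_finite u0).
  by apply: ge0_subset_integral => //; [exact: mX2|move=> w _; rewrite lee_fin sqr_ge0].
have v0 i : 0 <= v i by apply: fine_ge0; apply: integral_ge0 => w _; rewrite lee_fin sqr_ge0.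
have aq i : phi0 * a i <= q i - q (i + M)%N.
  rewrite -lee_fin EFinM prob_fineK // EFinB !prob_fineK //.
  apply: le_trans (HM (t + i)%N (A i) (ti i) (FA i) _) _; first by move=> w [].
  have -> : (P (no_zero t (t + i)) - P (no_zero t (t + (i + M))) =
      P (no_zero t (t + i) `\` no_zero t (t + (i + M))))%E.
    rewrite measureD //; last by rewrite -ge0_fin_numE // fin_num_measure.
    by rewrite setIidr //; apply: subset_no_zero; lia.
  apply: le_measure; rewrite ?inE.
  - apply: measurableD => //; exact: measurable_no_zero.
  - by apply: measurableD.
  - move=> w [[Gw _] nz]; split => //; apply: contra_not nz => /no_zeroP h.
    by apply/no_zeroP => u ? ?; apply: h; lia.
have vq i : v i.+1 + kap * q i <= v i + L * a i.
  have := H (t + i)%N _ (ti i) (FG i).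
  rewrite -/(A i) -(prob_fineK P (mG i)) -(prob_fineK P (mA i)).
  rewrite -(fineK (vfin (t + i)%N _ (ti i) (mG i))).
  rewrite -(fineK (vfin (t + i).+1 _ isT (mG i))).
  rewrite -!EFinM -!EFinD lee_fin => h.
  apply: le_trans h; rewrite lerD2r /v addnS.
  rewrite fine_le ?vfin //.
  - by exact: measurable_no_zero.
  - apply: ge0_subset_integral => //.
    + by exact: measurable_no_zero.
    + exact: mX2.
    + by move=> w _; rewrite lee_fin sqr_ge0.
    + by apply: subset_no_zero; lia.
exists ((v 0%N + L * (M%:R / phi0)) / kap) => n.
rewrite ler_pdivlMr // mulrC mulr_sumr.
have sa : \sum_(0 <= i < n) a i <= M%:R / phi0.
  rewrite ler_pdivlMr // mulrC mulr_sumr.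
  by apply: le_trans (sum_shift_diff_le M n q01); apply: ler_sum.
have : v n + \sum_(0 <= i < n) kap * q i <= v 0%N + L * \sum_(0 <= i < n) a i.
  elim: n {sa} => [|n IH]; first by rewrite !big_geq // mulr0 !addr0.
  rewrite !big_nat_recr //= mulrDr; have := vq n; lra.
have : L * \sum_(0 <= i < n) a i <= L * (M%:R / phi0) by rewrite ler_wpM2l.
have := v0 n; lra.
Qed.

Lemma ae_next_zero : {ae P, forall w, forall t, (0 < t)%N -> exists u, (t < u)%N /\ X u w = 0}.
Proof.
apply: ae_foralln => t.
have [->|t0] := posnP t; first exact: aeW.
have [B HB] := sum_no_zero_bounded t0.
pose N := \bigcap_i no_zero t (t + i).
have mG i : measurable (no_zero t (t + i)) by exact: measurable_no_zero.
have mN : measurable N by exact: bigcap_measurable.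
have N0 : P N = 0%E.
  rewrite -prob_fineK //; congr (_%:E); apply/eqP; rewrite eq_le prob_fine_ge0 andbT.
  rewrite leNgt; apply/negP => N0.
  have [n] : exists n : nat, B < n%:R * fine (P N).
    exists (Num.trunc (`|B| / fine (P N))).+1; rewrite -ltr_pdivrMr //.
    by apply: le_lt_trans (truncnS_gt _); rewrite ler_pM2r ?invr_gt0 // ler_norm.
  rewrite ltNge => /negP; apply; apply: le_trans (HB n).
  rewrite mulrC mulr_natr -[in leLHS](subn0 n) -sumr_const_nat; apply: ler_sum => i _.
  apply: fine_le; rewrite ?fin_num_measure //; apply: le_measure; rewrite ?inE //.
  by move=> w; apply.
exists N; split => //= w; apply: contra_notP => nN t1.
have /existsNP[i /not_implyP[_ /no_zeroP]] := nN.
move=> /existsNP[u /not_implyP[tu /not_implyP[_ /contrapT Xu]]].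
by exists u.
Qed.

End drift.

(** * Series and almost sure equality *)

Section series_lemmas.
Context {R : realType}.

Lemma nneseries_eventually0 (f : nat -> \bar R) (n : nat) :
  (forall i, (n <= i)%N -> f i = 0%E) ->
  (\sum_(i <oo) f i = \sum_(0 <= i < n) f i)%E.
Proof.
move=> f0; apply: cvg_lim => //.
apply: cvg_near_cst; exists n => // m /= nm.
rewrite (big_cat_nat (n := n)) //= [X in (_ + X)%E](_ : _ = 0%E) ?adde0 //.
rewrite big_nat_cond big1 //; by move=> i /andP[/andP[ni _] _]; exact: f0.
Qed.

Lemma cvg_series_of_nneseries (a : nat -> R) (m : R) : (forall j, 0 <= a j) ->
  (\sum_(j <oo) (a j)%:E = m%:E)%E -> series a @ \oo --> m.
Proof.
move=> a0 am.
have : (fun n => \sum_(0 <= j < n) (a j)%:E)%E @ \oo --> m%:E.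
  rewrite -am; apply: is_cvg_nneseries => n _ _; by rewrite lee_fin.
rewrite (_ : (fun n => _) = EFin \o series a); last first.
  by apply/funext => n; rewrite /= /series /= sumEFin.
by move/fine_cvgP => [_].
Qed.

Lemma nneseries_le_bound (a : nat -> R) (B : R) : (forall j, 0 <= a j) ->
  (forall n, \sum_(0 <= j < n) a j <= B) -> (\sum_(j <oo) (a j)%:E <= B%:E)%E.
Proof.
move=> a0 aB; apply: lime_le.
  by apply: is_cvg_nneseries => n _ _; rewrite lee_fin.
by apply: nearW => n; rewrite sumEFin lee_fin.
Qed.

Lemma convolution_cvg (g u : nat -> R) (G l : R) : (forall j, 0 <= g j) ->
  series g @ \oo --> G -> (forall n, 0 <= u n <= 1) -> 0 <= l <= 1 -> u @ \oo --> l ->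
  (fun n => \sum_(i < n.+1) g i * u (n - i)%N) @ \oo --> G * l.
Proof.
move=> g0 gG u01 l01 ul.
have S_nd : nondecreasing_seq (series g).
  by apply/nondecreasing_seqP => n; rewrite /series /= big_nat_recr //= lerDl.
have S_le n : series g n <= G.
  by rewrite -(cvg_lim _ gG) //; apply: nondecreasing_cvgn_le => //; apply/cvg_ex; exists G.
have G0 : 0 <= G by apply: le_trans (S_le 0%N); rewrite /series /= big_geq.
apply/cvgrPdist_le => e e0.
pose e1 := e / (2 * (G + 1)).
have e10 : 0 < e1 by rewrite divr_gt0 // mulr_gt0 //; lra.
have e20 : 0 < e / 4 by rewrite divr_gt0.
move/cvgrPdist_le/(_ _ e10) : ul => [N1 _ H1].
move/cvgrPdist_le/(_ _ e20) : gG => [K _ HK].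
exists (N1 + K)%N => // n /= Nn.
have -> : G * l - \sum_(i < n.+1) g i * u (n - i)%N =
    (G - series g n.+1) * l + \sum_(0 <= i < n.+1) g i * (l - u (n - i)%N).
  under [in RHS]eq_bigr do rewrite mulrBr.
  rewrite -(big_mkord xpredT (fun i => g i * u (n - i)%N)) [in RHS]big_split /=.
  by rewrite -mulr_suml sumrN mulrBl /series /=; ring.
rewrite (big_cat_nat (n := K)) //=; last by lia.
have b1 : `|\sum_(0 <= i < K) g i * (l - u (n - i)%N)| <= G * e1.
  apply: le_trans (ler_norm_sum _ _ _) _.
  apply: (@le_trans _ _ (\sum_(0 <= i < K) g i * e1)).
    apply: ler_sum_nat => i /andP[_ iK]; rewrite normrM ger0_norm // ler_wpM2l //.
    by apply: H1 => /=; lia.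
  by rewrite -mulr_suml ler_wpM2r //; [exact: ltW|exact: S_le].
have b2 : `|\sum_(K <= i < n.+1) g i * (l - u (n - i)%N)| <= e / 4.
  apply: le_trans (ler_norm_sum _ _ _) _.
  apply: (@le_trans _ _ (\sum_(K <= i < n.+1) g i)).
    apply: ler_sum_nat => i _; rewrite normrM ger0_norm // ler_piMr //.
    have := u01 (n - i)%N; rewrite ler_norml; lra.
  have := S_le n.+1; have := HK K (leqnn K).
  rewrite {2}/series /= (big_cat_nat (n := K)) //=; last by lia.
  rewrite -[X in _ -> X + _ <= _ -> _]/(series g K) ler_norml; lra.
have b3 : `|(G - series g n.+1) * l| <= e / 4.
  have Kn : (K <= n.+1)%N by lia.
  have := HK n.+1 Kn; have := S_le n.+1; rewrite /= => h1.
  rewrite ger0_norm ?subr_ge0 // => h2.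
  rewrite ger0_norm ?mulr_ge0 ?subr_ge0 //; last by case/andP: l01.
  by apply: le_trans h2; rewrite ler_piMr ?subr_ge0 //; case/andP: l01.
have Ge : G * e1 <= e / 2.
  have -> : e / 2 = (G + 1) * e1 by rewrite /e1; field; rewrite gt_eqF //; lra.
  by rewrite ler_wpM2r ?ltW //; lra.
apply: le_trans (ler_normD _ _) _; apply: le_trans (lerD b3 (ler_normD _ _)) _.
lra.
Qed.

End series_lemmas.

Section ae_lemmas.
Context {d : measure_display} {T : measurableType d} {R : realType}.
Variable P : probability T R.

Lemma prob_eq_ae (A B : set T) : measurable A -> measurable B ->
  {ae P, forall w, A w <-> B w} -> P A = P B.
Proof.
move=> mA mB AB.
rewrite -(setIT A) -(setIT B) -!(integral_indic P measurableT) //.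
apply: ae_eq_integral => //.
- by apply/measurable_EFinP; exact: measurable_indic.
- by apply/measurable_EFinP; exact: measurable_indic.
apply: filterS AB => w AB _; rewrite !indicE; congr ((nat_of_bool _)%:R%:E).
by apply/idP/idP; rewrite !inE => /AB.
Qed.

Lemma prob_ae1 (A : set T) : measurable A -> {ae P, forall w, A w} -> P A = 1%E.
Proof.
move=> mA hA; rewrite (@prob_eq_ae A setT) ?probability_setT //.
by apply: filterS hA => w.
Qed.

Lemma fine_prob_partition (n : nat) (A : set T) (E : nat -> set T) : measurable A ->
  (forall i, (i < n)%N -> measurable (E i)) ->
  {ae P, forall w, (A w <-> exists2 i, (i < n)%N & E i w) /\
     forall i j, (i < n)%N -> (j < n)%N -> E i w -> E j w -> i = j} ->
  fine (P A) = \sum_(i < n) fine (P (E i)).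
Proof.
elim: n A => [|n IH] A mA mE H.
  rewrite big_ord0 (@prob_eq_ae A set0) ?measure0 //.
  by apply: filterS H => w [[h _] _]; split => // /h[].
pose A' := \bigcup_(i in [set i | (i < n)%N]) E i.
have mA' : measurable A' by apply: bigcup_measurable => i /= ni; apply: mE; lia.
rewrite big_ord_recr /= -(IH A' mA'); last 2 first.
- by move=> i ni; apply: mE; lia.
- apply: filterS H => w [_ h]; split.
    by split=> [[i]|[i]]; exists i.
  by move=> i j ni nj; apply: h; lia.
have mEn : measurable (E n) by exact: mE.
rewrite (@prob_eq_ae A (A' `|` (E n `\` A'))) //; last 2 first.
- by apply: measurableU => //; exact: measurableD.
- apply: filterS H => w [-> _]; split.
    move=> [i]; rewrite ltnS leq_eqVlt => /orP[/eqP ->|ni] Ei; last by left; exists i.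
    by have [?|?] := pselect (A' w); [left|right].
  by move=> [[i ni Ei]|[En _]]; [exists i => //; rewrite ltnS ltnW|exists n].
rewrite measureU //; last 2 first.
- exact: measurableD.
- by apply/seteqP; split => w // [? []].
rewrite fineD ?fin_num_measure //; last exact: measurableD.
congr (_ + fine _); apply: prob_eq_ae => //; first exact: measurableD.
apply: filterS H => w [_ h]; split=> [[]//|En]; split => // -[i /= ni Ei].
have : i = n by apply: h => //; lia.
lia.
Qed.

Lemma integral_nat_series (f : T -> nat) : discrete_rv f ->
  (\int[P]_w ((f w)%:R)%:E = \sum_(j <oo) P [set w | (j < f w)%N])%E.
Proof.
move=> df.
have mj j : measurable [set w | (j < f w)%N].
  exact: (discrete_measurable (fun m => (j < m)%N) df).
transitivity (\int[P]_w \sum_(j <oo) (\1_[set w | (j < f w)%N] w)%:E)%E.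
  apply: eq_integral => w _; rewrite (@nneseries_eventually0 _ _ (f w)).
    rewrite sumEFin (eq_big_nat _ _ (F2 := fun=> 1)).
      by rewrite sumr_const_nat subn0.
    by move=> i /andP[_ ifw]; rewrite indicE mem_set.
  by move=> i fi; rewrite indicE memNset //= => ?; lia.
rewrite integral_nneseries //; last first.
  by move=> j; apply/measurable_EFinP; exact: measurable_indic.
by apply: eq_eseriesr => j _; rewrite integral_indic // setIT.
Qed.

Lemma discrete_of_fibers (U : Type) (f : T -> U) : countable (range f) ->
  (forall u, measurable [set w | f w = u]) -> discrete_rv f.
Proof.
move=> cf mf; split => // B.
rewrite (_ : _ @^-1` B = \bigcup_(y in range f `&` B) [set w | f w = y]); last first.
  by apply/seteqP; split => w /=; [move=> Bw; exists (f w)|move=> [y [_ By] /= ->]].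
apply: countable_bigcup_measurable => [|y _ //].
by apply: sub_countable cf; apply: subset_card_le => ? [].
Qed.

End ae_lemmas.

(** * Excursions *)

Section excursion_paths.
Context {d : measure_display} {T : measurableType d} {R : realType}.
Variable X : nat -> T -> R.
Implicit Types w : T.

Lemma next_zeroP s b w : next_zero X s w = Some b <->
  [/\ (s < b)%N, X b w = 0 & forall u, (s < u)%N -> (u < b)%N -> X u w <> 0].
Proof.
rewrite /next_zero; case: pselect => [h|h]; last first.
  by split=> // -[sb Xb _]; exfalso; apply: h; exists b.
case: ex_minnP => m /andP[sm /asboolP Xm] mmin; split.
  move=> [<-]; split => // u su um Xu.
  by have := mmin u; rewrite su /= => /(_ (asboolT Xu)); lia.
move=> [sb Xb H]; congr Some; apply/eqP; rewrite eqn_leq mmin ?sb /= ?asboolT //.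
by rewrite leqNgt; apply/negP => mb; exact: (H m).
Qed.

Lemma next_zero_None s w : next_zero X s w = None <->
  forall u, (s < u)%N -> X u w <> 0.
Proof.
rewrite /next_zero; case: pselect => [h|h].
  by split=> // H; case: h => u [su Xu]; have := H u su.
by split=> // _ u su Xu; apply: h; exists u.
Qed.

Definition recurrent_path w := forall t, (0 < t)%N -> exists u, (t < u)%N /\ X u w = 0.

Definition tau_nat n w := odflt 0%N (tau X n w).

Lemma tau_recurrent n w : recurrent_path w -> tau X n w = Some (tau_nat n w) /\ (0 < tau_nat n w)%N.
Proof.
move=> rw; rewrite /tau_nat; elim: n => [//|n [IH t0]] /=.
rewrite IH /=; case E : (next_zero X _ w) => [b|] /=.
  by have /next_zeroP[? _ _] := E; split => //; lia.
have /next_zero_None H := E; have [u [tu Xu]] := rw _ t0.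
by have := H u tu.
Qed.

Lemma tau_natS n w : recurrent_path w ->
  [/\ (tau_nat n w < tau_nat n.+1 w)%N, X (tau_nat n.+1 w) w = 0 &
   forall u, (tau_nat n w < u)%N -> (u < tau_nat n.+1 w)%N -> X u w <> 0].
Proof.
move=> rw; apply/next_zeroP.
have [E1 _] := tau_recurrent n.+1 rw; have [E0 _] := tau_recurrent n rw.
by rewrite -E1 /= E0.
Qed.

Lemma excursion_recurrent n w : recurrent_path w ->
  excursion X n.+1 w = [seq X t w | t <- iota (tau_nat n w) (tau_nat n.+1 w - tau_nat n w)].
Proof.
move=> rw; rewrite /excursion.
by rewrite (tau_recurrent n rw).1 (tau_recurrent n.+1 rw).1.
Qed.

Lemma size_excursion n w : recurrent_path w ->
  size (excursion X n.+1 w) = (tau_nat n.+1 w - tau_nat n w)%N.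
Proof. by move=> rw; rewrite excursion_recurrent // size_map size_iota. Qed.

Lemma tau_nat_sum n w : recurrent_path w ->
  tau_nat n w = (1 + \sum_(0 <= i < n) size (excursion X i.+1 w))%N.
Proof.
move=> rw; elim: n => [|n IH]; first by rewrite big_geq.
rewrite big_nat_recr //= addnA -IH size_excursion //.
by have [] := tau_natS n rw; lia.
Qed.

Lemma tau_nat_cover t w : recurrent_path w -> (0 < t)%N ->
  exists2 n, (n < t)%N & (tau_nat n w <= t < tau_nat n.+1 w)%N.
Proof.
move=> rw t0.
have ge n : (n < tau_nat n w)%N.
  by elim: n => [//|n IH]; have [] := tau_natS n rw; lia.
have ex : exists n, (tau_nat n w <= t)%N by exists 0%N.
have bd n : (tau_nat n w <= t)%N -> (n <= t)%N by have := ge n; lia.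
have [n ln nmax] := ex_maxnP ex bd.
exists n; first by have := ge n; lia.
rewrite ln /= ltnNge; apply/negP => /nmax; lia.
Qed.

Lemma tau_nat_inj m n w : recurrent_path w -> tau_nat m w = tau_nat n w -> m = n.
Proof.
move=> rw.
have inc : {homo (fun i => tau_nat i w) : i j / (i < j)%N}.
  by apply: homo_ltn => [|i]; [exact: ltn_trans|have [] := tau_natS i rw].
by case: (ltngtP m n) => // /inc /=; lia.
Qed.

Lemma zero_iff_tau t w : recurrent_path w -> X 1 w = 0 -> (0 < t)%N ->
  X t w = 0 <-> exists2 n, (n < t)%N & tau_nat n w = t.
Proof.
move=> rw X1 t0; split.
  move=> Xt; have [n nt /andP[h1 h2]] := tau_nat_cover rw t0.
  exists n => //; apply/eqP; rewrite eqn_leq h1 /= leqNgt; apply/negP => h.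
  by have [_ _ H] := tau_natS n rw; exact: (H t).
by move=> [[|n] _ <-] //; have [] := tau_natS n rw.
Qed.

Lemma Locc_tau n x w : recurrent_path w ->
  Locc X (tau_nat n w).-1 x w = \sum_(0 <= i < n) (count_mem x (excursion X i.+1 w))%:R.
Proof.
move=> rw; elim: n => [|n IH]; first by rewrite /Locc !big_geq.
rewrite big_nat_recr //= -IH /Locc.
have [h _ _] := tau_natS n rw; have [_ h0] := tau_recurrent n rw.
rewrite !prednK //; last lia.
rewrite (big_cat_nat (n := tau_nat n w)) //=; last lia.
congr (_ + _); rewrite excursion_recurrent // -sum1_count big_map /index_iota.
rewrite natr_sum [RHS]big_mkcond /=.
by apply: eq_bigr => i _; case: (_ == _).
Qed.

Lemma in_exc1P t w : in_exc X 1%N t w <-> (0 < t)%N /\ no_zero X 1 t w.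
Proof.
rewrite /in_exc /=; case E : (next_zero X 1 w) => [b|].
  have /next_zeroP[b1 Xb H] := E; split.
    by move=> /andP[t0 tb]; split => //; apply/no_zeroP => u u1 ut; apply: H; lia.
  move=> [t0 /no_zeroP nz]; rewrite t0 /= ltnNge; apply/negP => bt.
  exact: (nz b).
have /next_zero_None H := E; split=> [t0|[]//].
by split => //; apply/no_zeroP => u u1 _; exact: H.
Qed.

Lemma no_zero_size n i w : recurrent_path w ->
  no_zero X (tau_nat n w) (tau_nat n w + i) w <-> (i < size (excursion X n.+1 w))%N.
Proof.
move=> rw; have [h0 Xt H] := tau_natS n rw; rewrite size_excursion //; split.
  move=> /no_zeroP nz; rewrite ltnNge; apply/negP => h.
  by apply: (nz (tau_nat n.+1 w)) => //; lia.
by move=> h; apply/no_zeroP => u h1 h2; apply: H; lia.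
Qed.

Lemma nth_excursion n i w : recurrent_path w -> (i < size (excursion X n.+1 w))%N ->
  nth 0 (excursion X n.+1 w) i = X (tau_nat n w + i)%N w.
Proof.
move=> rw; rewrite size_excursion // => h.
by rewrite excursion_recurrent // (nth_map 0%N) ?size_iota // nth_iota.
Qed.

End excursion_paths.

Section stationary_occupation.
Context {d : measure_display} {T : measurableType d} {R : realType}.
Variable P : probability T R.
Variables (S : set R) (X : nat -> T -> R) (F : nat -> set (set T)).
Hypothesis hA0 : A0 P S X F.
Hypothesis hA1 : A1 P S X F.
Hypothesis hA3a : A3a P X.
Hypothesis rec : {ae P, forall w, recurrent_path X w}.
Hypothesis bounded : exists B : R, forall n,
  \sum_(0 <= i < n) fine (P (no_zero X 1 (1 + i))) <= B.

Local Notation Y := (fun i => excursion X i.+1).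

Lemma ae_start : {ae P, forall w, recurrent_path X w /\ X 1 w = 0}.
Proof.
have [_ _ _ _ [_ _ _ _ X1]] := hA0.
have m1 : measurable [set w | X 1 w = 0].
  by apply: (discrete_measurable (fun r => r = 0)); exact: (discrete_X hA0).
have h : {ae P, forall w, X 1 w = 0}.
  exists (~` [set w | X 1 w = 0]); split => //; first exact: measurableC.
  by apply: (etrans (probability_setC P m1)); rewrite X1 subee.
by apply: filterS2 rec h.
Qed.

Lemma measurable_X_in t (D : set R) : (0 < t)%N -> measurable [set w | D (X t w)].
Proof. by move=> t0; apply: (discrete_measurable D); exact: (discrete_X hA0). Qed.

Lemma discrete_next_zero s : discrete_rv (next_zero X s).
Proof.
have mSome b : measurable [set w | next_zero X s w = Some b].
  have [sb|bs] := ltnP s b.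
    rewrite (_ : mkset _ = [set w | X b w = 0] `&` no_zero X s b.-1).
      apply: measurableI; last exact: (measurable_no_zero hA0).
      by apply: (measurable_X_in (fun r => r = 0)); lia.
    apply/seteqP; split => w.
      move=> /next_zeroP[_ Xb H]; split => //; apply/no_zeroP => u su ub; apply: H; lia.
    move=> [/= Xb /no_zeroP H]; apply/next_zeroP; split => // u su ub; apply: H; lia.
  rewrite (_ : mkset _ = set0) //; apply/seteqP; split => w // /next_zeroP[]; lia.
apply: discrete_of_fibers => [|[b|]]; [exact: countableP|exact: mSome|].
rewrite (_ : mkset _ = ~` \bigcup_b [set w | next_zero X s w = Some b]).
  by apply: measurableC; exact: bigcup_measurable.
apply/seteqP; split => w /=; first by move=> /= h [b _ /=]; rewrite h.
by case E : (next_zero X s w) => [b|//] H; exfalso; apply: H; exists b.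
Qed.

Lemma discrete_tau n : discrete_rv (tau X n).
Proof.
elim: n => [|n IH] /=; first exact: discrete_cst.
apply: (@discrete_bind _ _ _ _ (tau X n)
  (fun o w => if o is Some s then next_zero X s w else None)) => // -[s|].
  exact: discrete_next_zero.
exact: discrete_cst.
Qed.

Lemma tau_gt0 n w a : tau X n w = Some a -> (0 < a)%N.
Proof.
case: n => [[<-]//|n] /=; case: (tau X n w) => // s /next_zeroP[]; lia.
Qed.

(* [X 0] is not assumed measurable, hence the guard [0 < a] in the auxiliary functions. *)
Lemma discrete_excursion n : discrete_rv (excursion X n).
Proof.
pose h (o : option nat) w : seq R := if o is Some a then
  if (0 < a)%N then
    if tau X n w is Some b then [seq X t w | t <- iota a (b - a)] else [::]
  else [::] else [::].
rewrite (_ : excursion X n = (fun w => h (tau X n.-1 w) w)); last first.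
  apply/funext => w; rewrite /excursion /h.
  case E : (tau X n.-1 w) => [a|//].
  by rewrite (tau_gt0 E).
apply: discrete_bind; first exact: discrete_tau.
move=> [a|]; rewrite /h; last exact: discrete_cst.
case: ltnP => a0; last exact: discrete_cst.
apply: (@discrete_bind _ _ _ _ (tau X n) (fun o w =>
  if o is Some b then [seq X t w | t <- iota a (b - a)] else [::])).
  exact: discrete_tau.
move=> [b|]; last exact: discrete_cst.
by apply: discrete_seq => u; rewrite mem_iota => hu; apply: (discrete_X hA0); lia.
Qed.

Lemma measurable_Ninf : measurable (Ninf X).
Proof.
rewrite (_ : Ninf X = \bigcap_n [set w | tau X n w <> None]).
  apply: bigcap_measurable => // n _.
  by apply: (discrete_measurable (fun o => o <> None)); exact: discrete_tau.
by apply/seteqP; split => w H; [move=> n _; exact: H|move=> n; exact: (H n I)].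
Qed.

Lemma prob_Ninf : P (Ninf X) = 1%E.
Proof.
apply: prob_ae1; first exact: measurable_Ninf.
by apply: filterS rec => w rw n; rewrite (tau_recurrent n rw).1.
Qed.

Lemma iid_excursions (k : nat) (B : nat -> set (seq R)) :
  fine (P (\bigcap_(i in [set i | (i < k)%N]) [set w | B i (Y i w)])) =
  \prod_(i < k) fine (P [set w | B i (Y 0 w)]).
Proof.
have mN := measurable_Ninf.
have drop A : measurable A -> P (Ninf X `&` A) = P A.
  move=> mA; apply: prob_eq_ae => //; first exact: measurableI.
  apply: filterS rec => w rw; split=> [[]//|Aw]; split => // n.
  by rewrite (tau_recurrent n rw).1.
have mB i j : measurable [set w | B i (Y j w)].
  by apply: discrete_measurable; exact: discrete_excursion.
have := hA3a k B.
rewrite prob_Ninf /= expr1n !mul1r drop; last by apply: bigcap_measurableType.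
by move=> ->; apply: eq_bigr => i _; rewrite drop.
Qed.

Local Notation dY := (fun i => discrete_excursion i.+1).

Definition occ_prob (D : set R) (i : nat) : R :=
  fine (P (no_zero X 1 (1 + i) `&` [set w | D (X (1 + i)%N w)])).

Lemma measurable_occ_prob D i :
  measurable (no_zero X 1 (1 + i) `&` [set w | D (X (1 + i)%N w)]).
Proof.
by apply: measurableI; [exact: (measurable_no_zero hA0)|exact: measurable_X_in].
Qed.

Lemma occ_prob_ge0 D i : 0 <= occ_prob D i.
Proof. exact: prob_fine_ge0. Qed.

Lemma occ_prob_setT i : occ_prob setT i = fine (P (no_zero X 1 (1 + i))).
Proof.
rewrite /occ_prob (_ : _ `&` _ = no_zero X 1 (1 + i)) //.
by apply/seteqP; split => w // [].
Qed.

Lemma occ_prob_le D i : occ_prob D i <= occ_prob setT i.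
Proof.
apply: fine_le; rewrite ?fin_num_measure //; try exact: measurable_occ_prob.
apply: le_measure; rewrite ?inE; try exact: measurable_occ_prob.
by move=> w [? ?].
Qed.

Lemma occ_prob_excursion D i :
  P [set w | (i < size (Y 0 w))%N /\ D (nth 0 (Y 0 w) i)] = (occ_prob D i)%:E.
Proof.
rewrite prob_fineK; last exact: measurable_occ_prob.
apply: prob_eq_ae; first exact: (discrete_measurable
    (fun l => (i < size l)%N /\ D (nth 0 l i)) (discrete_excursion 1)).
  exact: measurable_occ_prob.
apply: filterS rec => w rw; split.
  by move=> [h Dn]; split; [apply/(no_zero_size 0 i rw)|rewrite nth_excursion in Dn].
move=> [/(no_zero_size 0 i rw) h Dn]; split => //.
by rewrite nth_excursion.
Qed.

Lemma regeneration D s i : (0 < s)%N ->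
  fine (P ([set w | X s w = 0] `&` (no_zero X s (s + i) `&` [set w | D (X (s + i)%N w)]))) =
  fine (P [set w | X s w = 0]) * occ_prob D i.
Proof.
move=> s0.
pose B := [set l : seq R | (i < size l)%N /\ D (nth 0 l i)].
pose C := [set ls : seq (seq R) | (1 + \sum_(l <- ls) size l)%N = s].
have Ctau k w : recurrent_path X w -> C (segment Y 0 k w) <-> tau_nat X k w = s.
  by move=> rw; rewrite tau_nat_sum // /C /segment /= big_map /index_iota subn0.
have mC k : measurable [set w | C (segment Y 0 k w)].
  by apply: discrete_measurable; apply: discrete_segment; exact: dY.
have mB k : measurable [set w | B (Y k w)].
  by apply: discrete_measurable; exact: dY.
rewrite (@fine_prob_partition _ _ _ P s _
  (fun k => [set w | B (Y k w)] `&` [set w | C (segment Y 0 k w)])).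
- rewrite (@fine_prob_partition _ _ _ P s [set w | X s w = 0]
    (fun k => [set w | C (segment Y 0 k w)])).
  + rewrite mulr_suml; apply: eq_bigr => k _.
    rewrite (prob_segment_next dY iid_excursions) occ_prob_excursion fineM ?fin_num_measure //.
    by rewrite mulrC.
  + exact: (measurable_X_in (fun r => r = 0)).
  + by [].
  + apply: filterS ae_start => w [rw X1]; split.
      split=> [/(zero_iff_tau rw X1 s0)[k ks tk]|[k ks /(Ctau _ _ rw) tk]].
        by exists k => //; apply/(Ctau k w rw).
      by apply/(zero_iff_tau rw X1 s0); exists k.
    move=> k k' _ _ /(Ctau _ _ rw) h /(Ctau _ _ rw) h'.
    by apply: (tau_nat_inj rw); rewrite h h'.
- apply: measurableI; first exact: (measurable_X_in (fun r => r = 0)).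
  by apply: measurableI; [exact: (measurable_no_zero hA0)|apply: measurable_X_in; lia].
- by move=> k _; exact: measurableI.
apply: filterS ae_start => w [rw X1]; split; last first.
  move=> k k' _ _ [_ /(Ctau _ _ rw) h] [_ /(Ctau _ _ rw) h'].
  by apply: (tau_nat_inj rw); rewrite h h'.
split.
  move=> [/= /(zero_iff_tau rw X1 s0)[k ks tk] [nz Ds]]; exists k => //.
  split; last by apply/(Ctau k w rw).
  rewrite -tk in nz Ds.
  have h : (i < size (Y k w))%N by apply/(no_zero_size k i rw).
  by split => //; rewrite nth_excursion.
move=> [k ks [[h Dn] /(Ctau k w rw) tk]].
rewrite nth_excursion // in Dn.
split; first by apply/zero_iff_tau => //; exists k.
by rewrite -tk; split => //; apply/(no_zero_size k i rw).
Qed.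

Definition zero_prob n := fine (P [set w | X n.+1 w = 0]).

Lemma zero_prob01 n : 0 <= zero_prob n <= 1.
Proof.
rewrite prob_fine_ge0 prob_fine_le1 //.
exact: (measurable_X_in (fun r => r = 0)).
Qed.

Lemma last_zero_decomposition D n :
  fine (P [set w | D (X n.+1 w)]) = \sum_(i < n.+1) occ_prob D i * zero_prob (n - i).
Proof.
rewrite (@fine_prob_partition _ _ _ P n.+1 _ (fun i => [set w | X (n - i).+1 w = 0] `&`
   (no_zero X (n - i).+1 ((n - i).+1 + i) `&` [set w | D (X ((n - i).+1 + i)%N w)]))).
- by apply: eq_bigr => i _; rewrite regeneration // mulrC.
- exact: measurable_X_in.
- move=> i _; apply: measurableI; first exact: (measurable_X_in (fun r => r = 0)).
  by apply: measurableI; [exact: (measurable_no_zero hA0)|apply: measurable_X_in; lia].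
apply: filterS ae_start => w [rw X1].
have ni i : (i < n.+1)%N -> ((n - i).+1 + i = n.+1)%N by lia.
split; last first.
  have one i j : (i < j)%N -> (j < n.+1)%N -> X (n - i).+1 w = 0 ->
      no_zero X (n - j).+1 ((n - j).+1 + j) w -> False.
    by move=> ij jn Xi /no_zeroP h; apply: (h (n - i).+1) => //; lia.
  move=> i j hi hj [/= Xi [nzi _]] [/= Xj [nzj _]].
  case: (ltngtP i j) => // ij; exfalso; first exact: (one i j).
  exact: (one j i).
split=> [Dn|[i hi [_ [_ /=]]]]; last by rewrite ni.
have ex : exists s, [&& (0 < s)%N, (s <= n.+1)%N & X s w == 0] by exists 1%N; rewrite X1 eqxx.
have bd s : [&& (0 < s)%N, (s <= n.+1)%N & X s w == 0] -> (s <= n.+1)%N by case/and3P.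
have [s /and3P[s0 sn /eqP Xs] smax] := ex_maxnP ex bd.
exists (n.+1 - s)%N; first lia.
have -> : ((n - (n.+1 - s)).+1 = s)%N by lia.
have -> : (s + (n.+1 - s) = n.+1)%N by lia.
split => //; split => //; apply/no_zeroP => u su un Xu.
have := smax u; rewrite Xu eqxx un andbT /=; lia.
Qed.

Lemma integral_eta : (\int[P]_w Defs.eta X 1%N w = \sum_(j <oo) (occ_prob setT j)%:E)%E.
Proof.
have deta : discrete_rv (Defs.eta X 1%N).
  apply: (@discrete_comp _ _ _ _ (tau X 1%N)
    (fun o => if o is Some b then ((b - 1)%N%:R)%:E else +oo%E)); exact: discrete_tau.
have dsize : discrete_rv (fun w => size (Y 0 w)) by apply: discrete_comp; exact: discrete_excursion.
rewrite (ae_eq_integral (fun w => ((size (Y 0 w))%:R)%:E)) //.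
- rewrite integral_nat_series //; apply: eq_eseriesr => j _.
  rewrite -occ_prob_excursion; congr (P _).
  by apply/seteqP; split => w //= [].
- exact: discrete_measurable_fun.
- apply: discrete_measurable_fun; exact: (@discrete_comp _ _ _ _ _ (fun n => (n%:R)%:E) dsize).
apply: filterS rec => w rw _; rewrite size_excursion // /Defs.eta.
by rewrite (tau_recurrent 0 rw).1 (tau_recurrent 1 rw).1.
Qed.

Lemma integral_ell x : (\int[P]_w ell X 1%N x w = \sum_(j <oo) (occ_prob [set x] j)%:E)%E.
Proof.
pose A t := [set w | in_exc X 1%N t w /\ X t w = x].
have A0 : A 0%N = set0 by apply/seteqP; split => w // [/in_exc1P[]].
have AS j : A (j + 1)%N = no_zero X 1 (1 + j) `&` [set w | [set x] (X (1 + j)%N w)].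
  rewrite addnC; apply/seteqP; split => w; first by move=> [/in_exc1P[_ nz] Xx].
  by move=> [nz Xx]; split => //; apply/in_exc1P.
have mA t : measurable (A t).
  by case: t => [|t]; rewrite ?A0 // -addn1 AS; exact: measurable_occ_prob.
rewrite /ell integral_nneseries //; last 2 first.
- move=> t; rewrite (_ : (fun w => _) = EFin \o \1_(A t)).
    by apply/measurable_EFinP; exact: measurable_indic.
  apply/funext => w /=; rewrite indicE; case: asboolP => h; first by rewrite mem_set.
  by rewrite memNset.
- by move=> t w _; case: ifP.
transitivity (\sum_(t <oo) P (A t))%E.
  apply: eq_eseriesr => t _; rewrite -[in RHS](setIT (A t)) -(integral_indic P measurableT) //.
  apply: eq_integral => w _; rewrite indicE; case: asboolP => h; first by rewrite mem_set.
  by rewrite memNset.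
rewrite (@nneseries_recl _ xpredT (fun t => P (A t))) //.
rewrite A0 measure0 add0e -(@nneseries_addn _ _ 1) //.
by apply: eq_eseriesr => j _; rewrite AS prob_fineK //; exact: measurable_occ_prob.
Qed.

Lemma integral_count x :
  (\int[P]_w ((count_mem x (Y 0 w))%:R)%:E = \sum_(j <oo) (occ_prob [set x] j)%:E)%E.
Proof.
pose A j := [set w | (j < size (Y 0 w))%N /\ [set x] (nth 0 (Y 0 w) j)].
have mA j : measurable (A j).
  exact: (discrete_measurable (fun l => (j < size l)%N /\ [set x] (nth 0 l j))
    (discrete_excursion 1)).
transitivity (\int[P]_w \sum_(j <oo) (\1_(A j) w)%:E)%E.
  apply: eq_integral => w _; rewrite (@nneseries_eventually0 _ _ (size (Y 0 w))); last first.
    by move=> i hi; rewrite indicE memNset // => -[/= h _]; move: h; rewrite ltnNge hi.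
  rewrite sumEFin; congr (_%:E).
  rewrite -sum1_count (big_nth 0) big_mkcond natr_sum; apply: eq_big_nat => i /andP[_ hi].
  rewrite indicE /=; case: eqP => h; first by rewrite mem_set.
  by rewrite memNset // => -[].
rewrite integral_nneseries //; last by move=> j; apply/measurable_EFinP; exact: measurable_indic.
by apply: eq_eseriesr => j _; rewrite integral_indic // setIT; exact: occ_prob_excursion.
Qed.

Lemma mean_finite D : exists2 m : R, 0 <= m & (\sum_(j <oo) (occ_prob D j)%:E = m%:E)%E.
Proof.
have [B HB] := bounded.
have h : (\sum_(j <oo) (occ_prob D j)%:E <= B%:E)%E.
  apply: nneseries_le_bound => [j|n]; first exact: occ_prob_ge0.
  by apply: le_trans (HB n); apply: ler_sum => i _; rewrite -occ_prob_setT occ_prob_le.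
have h0 : (0 <= \sum_(j <oo) (occ_prob D j)%:E)%E.
  by apply: nneseries_ge0 => j _ _; rewrite lee_fin occ_prob_ge0.
exists (fine (\sum_(j <oo) (occ_prob D j)%:E)%E); first exact: fine_ge0.
by rewrite fineK // ge0_fin_numE //; apply: le_lt_trans h (ltry _).
Qed.

Definition mean_len := fine (\int[P]_w Defs.eta X 1%N w).
Definition mean_occ x := fine (\int[P]_w ell X 1%N x w).

Lemma mean_lenE : (\sum_(j <oo) (occ_prob setT j)%:E = mean_len%:E)%E.
Proof. by have [m _ mE] := mean_finite setT; rewrite /mean_len integral_eta mE. Qed.

Lemma mean_occE x : (\sum_(j <oo) (occ_prob [set x] j)%:E = (mean_occ x)%:E)%E.
Proof. by have [m _ mE] := mean_finite [set x]; rewrite /mean_occ integral_ell mE. Qed.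

Lemma mean_occ_ge0 x : 0 <= mean_occ x.
Proof.
rewrite -lee_fin -mean_occE; apply: nneseries_ge0 => j _ _.
by rewrite lee_fin occ_prob_ge0.
Qed.

Lemma occ_prob_setT0 : occ_prob setT 0 = 1.
Proof.
rewrite occ_prob_setT (_ : no_zero X 1 _ = setT) ?probability_setT //.
by apply/seteqP; split => w // _; apply/no_zeroP => u; lia.
Qed.

Lemma mean_len_ge1 : 1 <= mean_len.
Proof.
rewrite -lee_fin -mean_lenE nneseries_recl //; last by move=> k _; rewrite lee_fin occ_prob_ge0.
rewrite occ_prob_setT0 leeDl //; apply: nneseries_ge0 => j _ _.
by rewrite lee_fin occ_prob_ge0.
Qed.

Lemma mean_occ_gt0 x : S x -> 0 < mean_occ x.
Proof.
move=> Sx; rewrite lt_neqAle mean_occ_ge0 andbT; apply/eqP => E0.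
have dc i : discrete_rv (fun w => count_mem x (Y i w)).
  by apply: discrete_comp; exact: discrete_excursion.
have c0 : P [set w | (0 < count_mem x (Y 0 w))%N] = 0%E.
  apply/eqP; rewrite eq_le measure_ge0 andbT.
  have : (\int[P]_w ((count_mem x (Y 0 w))%:R)%:E = 0)%E.
    by rewrite integral_count mean_occE -E0.
  rewrite integral_nat_series // => h; rewrite -h nneseries_recl // leeDl //.
  by apply: nneseries_ge0.
have ci i : P [set w | (0 < count_mem x (Y i w))%N] = 0%E.
  rewrite -c0.
  have := prob_segment_shift dY iid_excursions 1 [set ls | (0 < count_mem x (head [::] ls))%N] i.
  by rewrite /segment /=.
have nox : {ae P, forall w, forall i, count_mem x (Y i w) = 0%N}.
  apply: ae_foralln => i; exists [set w | (0 < count_mem x (Y i w))%N]; split.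
  - exact: (discrete_measurable (fun n => (0 < n)%N) (dc i)).
  - exact: ci.
  by move=> w /=; rewrite lt0n => h; apply/eqP => h0; apply: h.
have [S0 _ _ _ [_ _ _ FX X1]] := hA0.
have [m [phi [mphi H]]] := hA1.
have [m0 phi0] := mphi 0 x S0 Sx.
have F1 : F 1 [set w | X 1 w = 0] by exact: FX.
have m1 : measurable [set w | X 1 w = 0] by exact: (F_measurable hA0 _ F1).
have := H 1%N x isT Sx _ F1.
rewrite (eq_integral (fun=> (phi 0 x)%:E)); last by move=> w; rewrite inE /= => ->.
rewrite integral_cst_fine // X1 mulr1 leNgt => /negP; apply.
rewrite (@prob_eq_ae _ _ _ P _ set0) ?measure0 ?lte_fin //.
  apply: measurableI => //.
  apply: (discrete_measurable (f := fun w => X (1 + m (X 1%N w) x)%N w) (fun r => r = x)).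
  apply: (@discrete_bind _ _ _ _ (X 1%N) (fun r w => X (1 + m r x)%N w)).
    exact: (discrete_X hA0).
  by move=> r; apply: (discrete_X hA0); lia.
apply: filterS2 rec nox => w rw nw; split=> // -[/= X10 Xx].
set t := (1 + m (X 1%N w) x)%N in Xx.
have [n _ /andP[h1 h2]] := tau_nat_cover rw (isT : (0 < t)%N).
have : (0 < count_mem x (Y n w))%N.
  rewrite -has_count has_pred1 excursion_recurrent // -Xx; apply: map_f.
  rewrite mem_iota; lia.
by rewrite nw.
Qed.

Lemma pi_statE x : pi_stat P X x = mean_occ x / mean_len.
Proof. by []. Qed.

Lemma pi_stat_gt0 x : S x -> 0 < pi_stat P X x.
Proof.
move=> Sx; rewrite pi_statE divr_gt0 ?mean_occ_gt0 //.
by have := mean_len_ge1; lra.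
Qed.

Lemma esum_pi_stat : (\esum_(x in S) (pi_stat P X x)%:E = 1)%E.
Proof.
have cS := countable_S hA0.
have [_ _ Sfin Sunb _] := hA0.
have infS : infinite_set S.
  move=> fS; have /finite_seqP[s sE] := fS.
  have [b Hb] : exists b, forall x, x \in s -> x <= b.
    elim: (s) => [|y l [b IH]]; first by exists 0.
    exists (Num.max y b) => x; rewrite in_cons le_max => /orP[/eqP ->|/IH ->].
      by rewrite lexx.
    by rewrite orbT.
  have [x [Sx]] := Sunb b.
  by rewrite ltNge => /negP; apply; apply: Hb; move: Sx; rewrite sE.
have /card_esym/card_set_bijP[e ebij] := eq_card_nat cS infS.
rewrite (reindex_esum setT S e) // -nneseries_esumT; last first.
  move=> n; rewrite lee_fin ltW // pi_stat_gt0 //; have [eS _ _] := ebij; exact: eS.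
have mu0 : 0 < mean_len by have := mean_len_ge1; lra.
under eq_eseriesr do rewrite pi_statE mulrC EFinM -mean_occE.
rewrite nneseriesZl; last first.
  by move=> n _; apply: nneseries_ge0 => j _ _; rewrite lee_fin occ_prob_ge0.
rewrite (@nneseries_interchange _ (fun n j => (occ_prob [set e n] j)%:E)); last first.
  by move=> n j; rewrite lee_fin occ_prob_ge0.
rewrite (_ : (\sum_(j <oo) _)%E = (\sum_(j <oo) (occ_prob setT j)%:E)%E).
  by rewrite mean_lenE -EFinM mulVf // gt_eqF.
apply: eq_eseriesr => j _.
rewrite occ_prob_setT prob_fineK; last exact: (measurable_no_zero hA0).
have -> : no_zero X 1 (1 + j) =
    \bigcup_n (no_zero X 1 (1 + j) `&` [set w | [set e n] (X (1 + j)%N w)]).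
  apply/seteqP; split=> [w nz|w [n _ []//]].
  have [_ _ esurj] := ebij.
  have [n _ en] := esurj _ (X_in_S hA0 w (isT : (0 < 1 + j)%N)).
  by exists n.
rewrite measure_bigcup //.
- rewrite [RHS]eseries_mkcond; apply: eq_eseriesr => n _.
  by rewrite in_setT prob_fineK //; exact: measurable_occ_prob.
- by move=> n _; exact: measurable_occ_prob.
- apply/trivIsetP => m n _ _ /eqP mn; apply/seteqP; split => w // [[_ /= h1] [_ /= h2]].
  apply: mn; have [_ einj _] := ebij; apply: einj; rewrite ?inE //.
  by rewrite -h1.
Qed.

Lemma pi_stat_ge0 x : 0 <= pi_stat P X x.
Proof.
by rewrite pi_statE divr_ge0 ?mean_occ_ge0 //; have := mean_len_ge1; lra.
Qed.

Lemma pi_stat_le1 x : pi_stat P X x <= 1.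
Proof.
have mu0 : 0 < mean_len by have := mean_len_ge1; lra.
rewrite pi_statE ler_pdivrMr // mul1r -lee_fin -mean_lenE -mean_occE.
apply: lee_nneseries => [j _ _|j _]; rewrite lee_fin ?occ_prob_ge0 //.
exact: occ_prob_le.
Qed.

Lemma Locc_homo x w : {homo (fun t => Locc X t x w) : s t / (s <= t)%N >-> s <= t}.
Proof.
apply: homo_leq => [//|? ? ?|n]; first exact: le_trans.
by rewrite /Locc [leRHS]big_nat_recr //= lerDl.
Qed.

Lemma occupation_ae x :
  {ae P, forall w, (fun t : nat => Locc X t x w / t%:R) @ \oo --> pi_stat P X x}.
Proof.
have ic (h : seq R -> nat) (m : R) : (\int[P]_w ((h (Y 0 w))%:R)%:E = m%:E)%E ->
    P.-integrable setT (fun w => ((h (Y 0 w))%:R)%:E).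
  move=> hm; apply/integrableP; split.
    apply: discrete_measurable_fun.
    exact: (@discrete_comp _ _ _ _ _ (fun l => ((h l)%:R)%:E) (discrete_excursion 1)).
  by under eq_integral do rewrite /= normr_nat; rewrite hm ltry.
have hc : (\int[P]_w ((count_mem x (Y 0 w))%:R)%:E = (mean_occ x)%:E)%E.
  by rewrite integral_count mean_occE.
have hs : (\int[P]_w ((size (Y 0 w))%:R)%:E = mean_len%:E)%E.
  rewrite integral_nat_series; last by apply: discrete_comp; exact: discrete_excursion.
  rewrite -mean_lenE; apply: eq_eseriesr => j _; rewrite -occ_prob_excursion; congr (P _).
  by apply/seteqP; split => w //= [].
have s1 := slln (g := fun l => (count_mem x l)%:R) dY iid_excursions (ic _ _ hc) hc.
have s2 := slln (g := fun l => (size l)%:R) dY iid_excursions (ic _ _ hs) hs.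
have mu0 : 0 < mean_len by have := mean_len_ge1; lra.
apply: filterS3 rec s1 s2 => w rw c1 c2; rewrite pi_statE.
pose B n := (\sum_(0 <= i < n) size (Y i w))%N.
have tB n : tau_nat X n w = (B n).+1 by rewrite tau_nat_sum // add1n.
apply: (@cycle_ratio_cvg _ (fun n => \sum_(0 <= i < n) (count_mem x (Y i w))%:R) _ B) => //.
- by move=> n; have [] := tau_natS n rw; rewrite !tB.
- by move=> n; apply: sumr_ge0.
- by rewrite (_ : (fun n => _) = (fun n => (\sum_(0 <= i < n) (size (Y i w))%:R) / n%:R)) //;
    apply/funext => n; rewrite /B natr_sum.
- move=> n t Bt tBn; rewrite -!Locc_tau // !tB /=.
  by rewrite !Locc_homo // ltnW.
Qed.

Lemma occupation_Lq x (q : R) : 1 <= q ->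
  (fun t : nat => (\int[P]_w ((`|Locc X t x w / t%:R - pi_stat P X x| `^ q)%:E))%E)
    @ \oo --> 0%E.
Proof.
move=> q1.
pose f t w : R := Locc X t x w / t%:R.
have dL t : discrete_rv (fun w => Locc X t x w).
  rewrite (_ : (fun w => _) = (fun w => \sum_(y <- [seq X s w | s <- index_iota 1 t.+1])
      (y == x)%:R)); last by apply/funext => w; rewrite big_map.
  apply: (@discrete_comp _ _ _ _ (fun w => [seq X s w | s <- index_iota 1 t.+1])
    (fun l => \sum_(y <- l) (y == x)%:R)).
  apply: discrete_seq => s; rewrite mem_index_iota => hs.
  by apply: (discrete_X hA0); lia.
have mf t (D : set T) (h : R -> R) : measurable_fun D (fun w => (h (Locc X t x w))%:E).
  by apply: discrete_measurable_fun; exact: (@discrete_comp _ _ _ _ _ (fun r => (h r)%:E) (dL t)).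
have L0 t w : 0 <= Locc X t x w by apply: sumr_ge0.
have Lt t w : Locc X t x w <= t%:R.
  rewrite /Locc; apply: (@le_trans _ _ (\sum_(1 <= s < t.+1) 1)).
    by apply: ler_sum => s _; case: (_ == _).
  by rewrite sumr_const_nat subSS subn0.
have f01 t w : 0 <= f t w <= 1.
  rewrite /f; have [->|t0] := posnP t; first by rewrite invr0 mulr0 lexx ler01.
  by rewrite divr_ge0 //= ler_pdivrMr ?ltr0n // mul1r.
have pi0 := pi_stat_ge0 x; have pi1 := pi_stat_le1 x.
have [_ cv _] : [/\ P.-integrable setT (fun w : T => (pi_stat P X x)%:E),
   (fun t => \int[P]_w `|(f t w)%:E - (pi_stat P X x)%:E|)%E @ \oo --> 0%E &
   (fun t => \int[P]_w (f t w)%:E)%E @ \oo --> (\int[P]_w (pi_stat P X x)%:E)%E].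
  apply: (@dominated_convergence _ _ _ P _ measurableT (fun t w => (f t w)%:E) _ (cst 1%E)) => //.
  - by move=> t; exact: (mf t _ (fun r => r / t%:R)).
  - apply: filterS (occupation_ae x) => w cw _.
    by apply: cvg_EFin => //; exact: nearW.
  - exact: finite_measure_integrable_cst.
  - apply: aeW => w t _; rewrite /= lee_fin ger0_norm; first by case/andP: (f01 t w).
    by case/andP: (f01 t w).
apply: (squeeze_cvge _ (cvg_cst 0%E) cv).
apply: nearW => t; apply/andP; split.
  by apply: integral_ge0 => w _; rewrite lee_fin powR_ge0.
apply: ge0_le_integral => //.
- exact: (mf t _ (fun r => `|r / t%:R - pi_stat P X x| `^ q)).
- exact: (mf t _ (fun r => `|r / t%:R - pi_stat P X x|)).
move=> w _; rewrite -EFinB abse_EFin lee_fin -/(f t w).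
set y := `|_|; have y0 : 0 <= y by exact: normr_ge0.
have y1 : y <= 1 by have := f01 t w; rewrite /y ler_norml; lra.
have [->|yn0] := eqVneq y 0; first by rewrite powR0 // gt_eqF //; lra.
rewrite -[leRHS]powRr1 //; apply: ger_powR => //.
by rewrite lt_neqAle eq_sym yn0 y0.
Qed.

Lemma occupation_limit : eta1_aperiodic P X -> forall x,
  (fun t : nat => fine (P [set w | X t w = x])) @ \oo --> pi_stat P X x.
Proof.
move=> aper x.
have mu1 := mean_len_ge1.
have gs D m : (\sum_(j <oo) (occ_prob D j)%:E = m%:E)%E -> series (occ_prob D) @ \oo --> m.
  by apply: cvg_series_of_nneseries => j; exact: occ_prob_ge0.
have gdiff j : occ_prob setT j - occ_prob setT j.+1 = fine (P [set w | size (Y 0 w) = j.+1]).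
  rewrite -[occ_prob setT j]/(fine (occ_prob setT j)%:E).
  rewrite -[occ_prob setT j.+1]/(fine (occ_prob setT j.+1)%:E).
  rewrite -!occ_prob_excursion.
  have ds : discrete_rv (fun w => size (Y 0 w)) by apply: discrete_comp; exact: discrete_excursion.
  have m1 D i : measurable [set w | (i < size (Y 0 w))%N /\ D (nth 0 (Y 0 w) i)].
    exact: (discrete_measurable (fun l => (i < size l)%N /\ D (nth 0 l i)) (discrete_excursion 1)).
  have m2 : measurable [set w | size (Y 0 w) = j.+1].
    exact: (discrete_measurable (fun n => n = j.+1) ds).
  apply/eqP; rewrite subr_eq -fineD ?fin_num_measure // -measureU //; last first.
    by apply/seteqP; split => w // [/= -> []]; rewrite ltnn.
  apply/eqP; congr (fine (P _)); apply/seteqP; split => w /=.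
    have /= E : size (Y 0 w) = size (excursion X 1 w) by [].
    move=> [h _]; have [->|h'] := eqVneq (size (Y 0 w)) j.+1; [by left|right; split => //].
    by move: h h' => /=; lia.
  have /= E : size (Y 0 w) = size (excursion X 1 w) by [].
  by move=> [h|[h _]]; split => //; lia.
have ul : zero_prob @ \oo --> mean_len^-1.
  apply: (@renewal_limit _ (occ_prob setT)) => //.
  - exact: occ_prob_setT0.
  - exact: occ_prob_ge0.
  - by move=> n; rewrite -subr_ge0 gdiff prob_fine_ge0.
  - exact/gs/mean_lenE.
  - move=> k k1; apply: contrapT => H; apply: (aper k k1).
    have sz : {ae P, forall w, forall j, size (Y 0 w) = j.+1 -> (k %| j.+1)%N}.
      apply: ae_foralln => j; have [kj|kj] := boolP (k %| j.+1)%N; first exact: aeW.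
      have m2 : measurable [set w | size (Y 0 w) = j.+1].
        apply: (discrete_measurable (f := fun w => size (Y 0 w)) (fun n => n = j.+1)).
        by apply: discrete_comp; exact: discrete_excursion.
      exists [set w | size (Y 0 w) = j.+1]; split => //.
        apply: (etrans (esym (prob_fineK P m2))); congr (_%:E); apply/eqP.
        rewrite eq_le prob_fine_ge0 andbT leNgt; apply/negP => h.
        by apply: H; exists j => //; rewrite -subr_gt0 gdiff.
      by move=> w /= /not_implyP[].
    apply: prob_ae1.
      apply: (discrete_measurable (f := Defs.eta X 1%N)
        (fun y => exists j : nat, (0 < j)%N /\ y = ((k * j)%N%:R)%:E)).
      apply: (@discrete_comp _ _ _ _ (tau X 1%N)
        (fun o => if o is Some b then ((b - 1)%N%:R)%:E else +oo%E)); exact: discrete_tau.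
    apply: filterS2 rec sz => w rw sw.
    have [h _ _] := tau_natS 0 rw.
    have se := size_excursion 0 rw.
    have kd : (k %| size (Y 0 w))%N.
      by case E : (size (Y 0 w)) => [|j]; [rewrite dvdn0|exact: sw].
    exists (size (Y 0 w) %/ k)%N; split.
      by rewrite divn_gt0; [apply: dvdn_leq => //; rewrite se; lia|lia].
    rewrite mulnC divnK // se /Defs.eta.
    by rewrite (tau_recurrent 0 rw).1 (tau_recurrent 1 rw).1.
  - exact: zero_prob01.
  - move=> n; rewrite -last_zero_decomposition (_ : mkset _ = setT) ?probability_setT //.
have conv : (fun n => \sum_(i < n.+1) occ_prob [set x] i * zero_prob (n - i)) @ \oo -->
    mean_occ x * mean_len^-1.
  apply: convolution_cvg => //.
  - exact: occ_prob_ge0.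
  - exact/gs/mean_occE.
  - exact: zero_prob01.
  - by rewrite invr_ge0 invf_le1 ?mu1 ?andbT //; lra.
rewrite -cvg_shiftS pi_statE.
rewrite (_ : [sequence _]_n = (fun n => \sum_(i < n.+1) occ_prob [set x] i * zero_prob (n - i))) //.
by apply/funext => n /=; rewrite -last_zero_decomposition.
Qed.

End stationary_occupation.

Theorem theorem2p6 (d : measure_display) (T : measurableType d) (R : realType)
  (P : probability T R) (S : set R) (X : nat -> T -> R) (F : nat -> set (set T))
  (c s2 p : R) :
  A0 P S X F -> A1 P S X F -> A2 P X F c s2 -> A3a P X -> A3b P X ->
  1 < - (2 * c) / s2 -> 1 + (- (2 * c) / s2) < p -> Mp P X F p ->
  [/\ (forall x, S x -> 0 < pi_stat P X x),
      (\esum_(x in S) (pi_stat P X x)%:E = 1)%E,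
      (forall x, S x ->
         {ae P, forall w, (fun t : nat => Locc X t x w / t%:R) @ \oo --> pi_stat P X x}),
      (forall x (q : R), S x -> 1 <= q ->
         (fun t : nat => (\int[P]_w ((`|Locc X t x w / t%:R - pi_stat P X x| `^ q)%:E))%E)
           @ \oo --> 0%E) &
      (eta1_aperiodic P X -> forall x, S x ->
         (fun t : nat => fine (P [set w | X t w = x])) @ \oo --> pi_stat P X x)].
Proof.
move=> hA0 hA1 hA2 hA3a _ r1 rp hMp.
have p2 : 2 <= p by lra.
have rec : {ae P, forall w, recurrent_path X w}.
  exact: (ae_next_zero hA0 hMp p2 hA2 r1 hA1).
have bd := sum_no_zero_bounded hA0 hMp p2 hA2 r1 hA1 (isT : (0 < 1)%N).
split.
- by move=> x; exact: (pi_stat_gt0 hA0 hA1 hA3a rec bd).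
- exact: (esum_pi_stat hA0 hA1 hA3a rec bd).
- by move=> x _; exact: (occupation_ae hA0 hA3a rec bd).
- by move=> x q _; exact: (occupation_Lq hA0 hA3a rec bd).
- by move=> ap x _; exact: (occupation_limit hA0 hA3a rec bd ap).
Qed.
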